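(* Let $\mathcal{H}=\mathbb{C}^2$ and let $X=\{q\in\mathcal{B}(\mathcal{H}): q^2=q,\ \mathrm{Tr}(q)=1\}$ with the Riemannian metric $g$ given at $q\in X$ by the real part of $$(A,B)\mapsto \frac{2}{\|q\|}\mathrm{Tr}(A^*B)-\frac{1}{\|q\|^3}\mathrm{Tr}(A^*q)\,\mathrm{Tr}(Bq^* ),\qquad A,B\in \mathrm{T}_qX=\{A: qA+Aq=A\},$$ where $\|q\|=\sqrt{\mathrm{Tr}(q^*q)}$. Then $(X,g)$ is isometric, up to a multiplicative constant, to the Eguchi–Hanson metric.
   Context: $X$ is the space of all (not necessarily Hermitian) rank-$1$ projections of $\mathbb{C}^2$, which is identified with $\mathrm{T}^*\mathbb{P}^1$. The Eguchi–Hanson metric is the complete hyperkähler $4$-manifold given, for a scale parameter $a>0$, by $$\frac{dr^2}{1-a^4/r^4}+\frac{r^2}{4}\big(\sigma_1^2+\sigma_2^2\big)+\frac{r^2}{4}\Big(1-\frac{a^4}{r^4}\Big)\sigma_3^2$$ on $\{r>a\}\times (S^3/\{\pm1\})$, with $\sigma_1,\sigma_2,\sigma_3$ the standard left-invariant coframe on $S^3=SU(2)$ (with $d\sigma_1=-\sigma_2\wedge\sigma_3$ and cyclic permutations), completed by adding a $2$-sphere at $r=a$; metrics for different $a$ are homothetic. *)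

(* Defs.v *)
From mathcomp Require Import all_boot all_order all_algebra.
From mathcomp Require Import all_classical all_reals all_analysis.
From mathcomp.real_closed Require Import complex.

Set Implicit Arguments.
Unset Strict Implicit.
Unset Printing Implicit Defensive.
Import Order.TTheory GRing.Theory Num.Theory.
Import numFieldNormedType.Exports.

Local Open Scope classical_set_scope.
Local Open Scope ring_scope.
Local Open Scope sesquilinear_scope.

(** * Smooth maps and Riemannian metrics on subsets of normed spaces

    All ambient spaces used below are finite dimensional over [R]. A manifold
    is given as a subset of such a space, a map on it is smooth when it extends
    locally to a smooth map on an open subset of the ambient space, and a
    tangent vector is the velocity of a smooth curve in it. *)

(* Only meant for open [U] and finite-dimensional [V], where iterating
   directional derivatives along constant vectors gives the usual C^n. *)
Fixpoint Cn_on (R : realType) (V W : normedModType R) (n : nat) (U : set V)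
    (f : V -> W) : Prop :=
  match n with
  | 0%N => forall x, U x -> {for x, continuous f}
  | n'.+1 => (forall x, U x -> differentiable f x) /\
             (forall v : V, Cn_on n' U (fun x => 'D_v f x))
  end.

Definition smooth_on_open (R : realType) (V W : normedModType R) (U : set V)
    (f : V -> W) : Prop :=
  forall n, Cn_on n U f.

Definition smooth_on (R : realType) (V W : normedModType R) (M : set V)
    (f : V -> W) : Prop :=
  forall p, M p -> exists (U : set V) (f' : V -> W),
    [/\ open U, U p, smooth_on_open U f' & forall x, M x -> U x -> f x = f' x].

Definition smooth_curve (R : realType) (V : normedModType R) (M : set V)
    (p : V) (c : R -> V) : Prop :=
  c 0 = p /\ exists J : set R,
    [/\ open J, J 0, smooth_on_open J (c : R^o -> V) & forall t, J t -> M (c t)].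

Definition tangent (R : realType) (V : normedModType R) (M : set V) (p : V) :
    set V :=
  [set v | exists2 c : R -> V, smooth_curve M p c & v = derive1 c 0].

Definition tangent_pairs (R : realType) (V : normedModType R) (M : set V) :
    set (V * V * V) :=
  [set z | [/\ M z.1.1, tangent M z.1.1 z.1.2 & tangent M z.1.1 z.2]].

(* [g p v w] is only significant for [p] in [M] and [v], [w] tangent to [M] at
   [p]; smoothness of the tensor is smoothness of (p, v, w) |-> g_p(v, w). *)
Definition riemannian_metric (R : realType) (V : normedModType R) (M : set V)
    (g : V -> V -> V -> R) : Prop :=
  [/\ forall p u v w (k : R), M p ->
        tangent M p u -> tangent M p v -> tangent M p w ->
        g p (k *: u + v) w = k * g p u w + g p v w,
      forall p v w, M p -> tangent M p v -> tangent M p w ->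
        g p v w = g p w v,
      forall p v, M p -> tangent M p v -> v != 0 -> 0 < g p v v &
      smooth_on (tangent_pairs M) (fun z => g z.1.1 z.1.2 z.2 : R^o)].

(* F^* h = g on M, the differential of F being computed along curves in M. *)
Definition pullback_is (R : realType) (V W : normedModType R) (M : set V)
    (F : V -> W) (h : W -> W -> W -> R) (g : V -> V -> V -> R) : Prop :=
  forall (p : V) (c d : R -> V), smooth_curve M p c -> smooth_curve M p d ->
    h (F p) (derive1 (F \o c) 0) (derive1 (F \o d) 0)
    = g p (derive1 c 0) (derive1 d 0).

Definition diffeomorphism (R : realType) (V W : normedModType R)
    (M : set V) (N : set W) (F : V -> W) : Prop :=
  [/\ smooth_on M F, forall x, M x -> N (F x) &
      exists G : W -> V,
        [/\ smooth_on N G, forall y, N y -> M (G y),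
            forall x, M x -> G (F x) = x & forall y, N y -> F (G y) = y]].

Definition isometric (R : realType) (V W : normedModType R)
    (M : set V) (g : V -> V -> V -> R) (N : set W) (h : W -> W -> W -> R) :
    Prop :=
  exists2 F : V -> W, diffeomorphism M N F & pullback_is M F h g.

(** * Complex 2x2 matrices *)

(* B(C^2) as a real normed space: pairs (real part, imaginary part). *)
Definition realM2 (R : realType) : normedModType R := ('M[R]_2 * 'M[R]_2)%type.

Definition cmat (R : realType) (A : realM2 R) : 'M[R[i]]_2 :=
  \matrix_(i, j) (A.1 i j +i* A.2 i j)%C.

(** * Rank-one projections of C^2 *)

Definition proj1_space (R : realType) : set (realM2 R) :=
  [set q | cmat q *m cmat q = cmat q /\ \tr (cmat q) = 1].
Arguments proj1_space : clear implicits.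

Definition proj1_tangent (R : realType) (q : realM2 R) : set (realM2 R) :=
  [set A | cmat q *m cmat A + cmat A *m cmat q = cmat A].

Definition hsnorm (R : realType) (A : 'M[R[i]]_2) : R :=
  Num.sqrt (complex.Re (\tr (A^t* *m A))).

Definition proj1_metric (R : realType) (q A B : realM2 R) : R :=
  complex.Re
    ((2 / hsnorm (cmat q))%:C%C * \tr ((cmat A)^t* *m cmat B)
     - (1 / hsnorm (cmat q) ^+ 3)%:C%C
       * \tr ((cmat A)^t* *m cmat q) * \tr (cmat B *m (cmat q)^t*)).

(** * The Eguchi-Hanson metric *)

Definition SU2 (R : realType) : set (realM2 R) :=
  [set u | cmat u \is unitarymx /\ \det (cmat u) = 1].
Arguments SU2 : clear implicits.

Definition pauli1 (R : realType) : 'M[R[i]]_2 := \matrix_(i, j) (i != j)%:R.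
Definition pauli2 (R : realType) : 'M[R[i]]_2 :=
  \matrix_(i, j) ((i != j)%:R * ((-1) ^+ j * 'i%C)).
Definition pauli3 (R : realType) : 'M[R[i]]_2 :=
  \matrix_(i, j) ((i == j)%:R * (-1) ^+ i).
Definition pauli (R : realType) (k : 'I_3) : 'M[R[i]]_2 :=
  tnth [tuple pauli1 R; pauli2 R; pauli3 R] k.

(* The indices 1, 2, 3 are the elements 0, 1, 2 of ['I_3].
   The coframe is dual to the left-invariant frame e_k = -i/2 pauli_k, i.e.
   u^-1 du = sum_k sigma_k e_k; since [e_1, e_2] = e_3 and cyclically,
   d sigma_1 = - sigma_2 /\ sigma_3 and cyclically. *)
Definition sigma (R : realType) (k : 'I_3) (u xi : realM2 R) : R :=
  - complex.Im (\tr ((cmat u)^t* *m cmat xi *m pauli R k)).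

Definition EH_domain (R : realType) (a : R) : set (R^o * realM2 R) :=
  [set p | a < p.1 /\ SU2 R p.2].

(* The polarization of the quadratic form
   dr^2/(1-a^4/r^4) + r^2/4 (sigma_1^2 + sigma_2^2)
     + r^2/4 (1-a^4/r^4) sigma_3^2. *)
Definition EH_formula (R : realType) (a : R) (p v w : R^o * realM2 R) : R :=
  let r : R := p.1 in
  let s k := sigma k p.2 v.2 * sigma k p.2 w.2 in
  (v.1 * w.1) / (1 - a ^+ 4 / r ^+ 4)
  + r ^+ 2 / 4 * (s (inord 0) + s (inord 1))
  + r ^+ 2 / 4 * (1 - a ^+ 4 / r ^+ 4) * s (inord 2).

Definition dotr (R : realType) (x y : 'rV[R]_3) : R := \sum_k x 0 k * y 0 k.

(* The underlying manifold: the tangent bundle of the 2-sphere. *)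
Definition EH_space (R : realType) : set ('rV[R]_3 * 'rV[R]_3)%type :=
  [set z | dotr z.1 z.1 = 1 /\ dotr z.1 z.2 = 0].
Arguments EH_space : clear implicits.

(* The j-th column of the rotation Ad(u) in SO(3). *)
Definition Ad_col (R : realType) (u : realM2 R) (j : 'I_3) : 'rV[R]_3 :=
  \row_k (complex.Re
    (\tr (pauli R k *m cmat u *m pauli R j *m (cmat u)^t*)) / 2).

(* As u runs over SU(2) with u and -u identified, the pairs
   (Ad(u) e_3, Ad(u) e_1) run bijectively over the unit tangent vectors of the
   2-sphere. Hence, for r > a, this map identifies {r > a} x (S^3 / {1, -1})
   with the complement of the zero section in the tangent bundle; for r = a it
   collapses the orbits of the circle tangent to the field dual to sigma_3,
   with image the zero section, which is the added 2-sphere. *)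
Definition EH_chart (R : realType) (a : R) (p : R^o * realM2 R) :
    ('rV[R]_3 * 'rV[R]_3)%type :=
  (Ad_col p.2 (inord 2),
   Num.sqrt ((p.1 : R) ^+ 4 - a ^+ 4) *: Ad_col p.2 (inord 0)).

(* [h] is a smooth Riemannian metric on the whole bundle that is given by the
   Eguchi-Hanson formula off the zero section; by density of the complement of
   the zero section and continuity there is at most one such tensor. Its
   smoothness and nondegeneracy along the zero section also ensure that the
   differentiable structure near the added sphere is the right one. *)
Definition Eguchi_Hanson_metric (R : realType) (a : R)
    (h : ('rV[R]_3 * 'rV[R]_3)%type -> ('rV[R]_3 * 'rV[R]_3)%type ->
         ('rV[R]_3 * 'rV[R]_3)%type -> R) : Prop :=
  riemannian_metric (EH_space R) h /\
  pullback_is (EH_domain a) (EH_chart a) h (EH_formula a).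

(* Main.v *)
(* In the Bloch coordinates q = (1 + (x + iy).sigma)/2, with sigma the Pauli
   matrices, X is the quadric |x|^2 - |y|^2 = 1, x.y = 0, and ||q|| = |x|, so
   that (z, w) = (x/|x|, a^2 y) identifies X with the tangent bundle of the
   2-sphere. With rho = |x| = sqrt(1 + |w|^2/a^4), the metric (a^2/4) g becomes
     (a^2/4) (rho |dz|^2 + (|dw|^2 - (z.dw)^2) / (a^4 rho)),
   which is visibly smooth and positive across the zero section. Off the zero
   section put z = E3 and w = sqrt(r^4 - a^4) E1 for a rotating frame
   (E1, E2, E3) = Ad(u): then rho = r^2/a^2, and the structure equations
   dE3 = sigma_2 E1 - sigma_1 E2, dE1 = sigma_3 E2 - sigma_2 E3 turn this
   expression into the Eguchi-Hanson formula. *)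
From HB Require Import structures.
Require Import Defs.
From mathcomp Require Import all_boot all_order all_algebra.
From mathcomp Require Import all_classical all_reals all_analysis.
From mathcomp.real_closed Require Import complex.
From mathcomp Require Import ring lra.

Set Implicit Arguments.
Unset Strict Implicit.
Unset Printing Implicit Defensive.
Import Order.TTheory GRing.Theory Num.Theory.
Import numFieldNormedType.Exports.
Local Open Scope classical_set_scope.
Local Open Scope ring_scope.

(** * Calculus of C^n functions *)

Lemma near_eq_differentiable (R : realType) (V W : normedModType R)
    (f g : V -> W) (x : V) :
  {near x, f =1 g} -> differentiable f x -> differentiable g x.
Proof.
move=> fg df.
have e : g \o shift x = cst (g x) + 'd f x +o_ 0 id.
  apply/eqaddoP => _/posnumP[e].
  have /eqaddoP /(_ e%:num (gt0 e)) := diff_locally df.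
  have : \forall y \near 0, f (y + x) = g (y + x).
    by rewrite (near_shift x) sub0r; near=> y; rewrite /= subrK; near: y.
  move=> h1 h2; near=> y.
  have : f (y + x) = g (y + x) by near: y.
  have /= : `|(f \o shift x - (cst (f x) + 'd f x)) y| <= e%:num * `|id y|.
    by near: y.
  by rewrite !fctE /= => + <-; rewrite (nbhs_singleton fg).
have dE : 'd g x = 'd f x :> (V -> W).
  by apply: diff_unique => //; exact: diff_continuous.
by apply/diff_locallyP; rewrite dE; split => //; exact: diff_continuous.
Unshelve. all: by end_near. Qed.


Section SmoothCalculus.
Variables (R : realType) (V : normedModType R) (U : set V).
Hypothesis oU : open U.

Lemma Cn_on_ext (W : normedModType R) n (f g : V -> W) :
  (forall x, U x -> f x = g x) -> Cn_on n U f -> Cn_on n U g.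
Proof.
have near_fg (f' g' : V -> W) x : (forall x, U x -> f' x = g' x) -> U x ->
    {near x, f' =1 g'}.
  by move=> fg Ux; apply: filterS (open_nbhs_nbhs (conj oU Ux)).
elim: n f g => [|n IHn] f g fg /=.
  move=> cf x Ux; rewrite /prop_for /continuous_at -(fg _ Ux).
  exact: cvg_trans (near_eq_cvg (near_fg _ _ _ fg Ux)) (cf x Ux).
case=> df cf; split=> [x Ux|v].
  exact: near_eq_differentiable (near_fg _ _ _ fg Ux) (df x Ux).
apply: IHn (cf v) => x Ux; exact: near_eq_derive (near_fg _ _ _ fg Ux).
Qed.

Lemma Cn_onW (W : normedModType R) n (f : V -> W) :
  Cn_on n.+1 U f -> Cn_on n U f.
Proof.
elim: n f => [|n IHn] f [df cf].
  by move=> x Ux; exact/differentiable_continuous/df.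
by split=> // v; exact/IHn/cf.
Qed.

Lemma Cn_on_cst (W : normedModType R) n (w : W) : Cn_on n U (fun=> w).
Proof.
elim: n w => [|n IHn] w; first by move=> x _; exact: cvg_cst.
split=> [x _|v]; first exact: differentiable_cst.
by apply: Cn_on_ext (IHn 0) => x _; rewrite derive_cst.
Qed.

Lemma Cn_on_id n : Cn_on n U (id : V -> V).
Proof.
case: n => [|n]; first by move=> x _; exact: cvg_id.
split=> [x _|v]; first exact: ex_diff.
by apply: Cn_on_ext (Cn_on_cst n v) => x _; rewrite derive_id.
Qed.

Lemma Cn_on_linear (W W' : normedModType R) (L : {linear W -> W'}) n
    (f : V -> W) :
  continuous L -> Cn_on n U f -> Cn_on n U (L \o f).
Proof.
move=> cL; elim: n f => [|n IHn] f.
  move=> cf x Ux; apply: continuous_comp; [exact: cf|exact: cL].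
case=> df cf; have dL y : differentiable L y by exact: linear_differentiable.
split=> [x Ux|v]; first by apply: differentiable_comp => //; exact: df.
apply: Cn_on_ext (IHn _ (cf v)) => x Ux /=.
have dfx := df _ Ux; rewrite !deriveE //; last exact: differentiable_comp.
by rewrite (diff_comp dfx (dL _)) (diff_lin _ cL).
Qed.

Lemma Cn_on_add (W : normedModType R) n (f g : V -> W) :
  Cn_on n U f -> Cn_on n U g -> Cn_on n U (fun x => f x + g x).
Proof.
elim: n f g => [|n IHn] f g.
  by move=> cf cg x Ux; apply: cvgD; [exact: cf|exact: cg].
move=> [df cf] [dg cg]; split=> [x Ux|v].
  by apply: differentiableD; [exact: df|exact: dg].
apply: Cn_on_ext (IHn _ _ (cf v) (cg v)) => x Ux.
by rewrite deriveD//; apply: diff_derivable; [exact: df|exact: dg].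
Qed.

Lemma Cn_on_mul n (f g : V -> R^o) :
  Cn_on n U f -> Cn_on n U g -> Cn_on n U (fun x => f x * g x : R^o).
Proof.
elim: n f g => [|n IHn] f g.
  by move=> cf cg x Ux; apply: cvgM; [exact: cf|exact: cg].
move=> Cf Cg; have [df cf] := Cf; have [dg cg] := Cg; split=> [x Ux|v].
  by apply: differentiableM; [exact: df|exact: dg].
apply: Cn_on_ext (Cn_on_add (IHn _ _ (Cn_onW Cf) (cg v))
                            (IHn _ _ (Cn_onW Cg) (cf v))) => x Ux.
by rewrite deriveM//; apply: diff_derivable; [exact: df|exact: dg].
Qed.

Lemma Cn_on_opp n (f : V -> R^o) :
  Cn_on n U f -> Cn_on n U (fun x => - f x : R^o).
Proof.
move=> Cf; apply: Cn_on_ext (Cn_on_mul (Cn_on_cst n (-1 : R^o)) Cf) => x _.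
by rewrite mulN1r.
Qed.

Lemma Cn_on_inv n (f : V -> R^o) : (forall x, U x -> f x != 0) ->
  Cn_on n U f -> Cn_on n U (fun x => (f x)^-1 : R^o).
Proof.
move=> f0; elim: n f f0 => [|n IHn] f f0.
  by move=> cf x Ux; apply: cvgV; [exact: f0|exact: cf].
move=> Cf; have [df cf] := Cf; split=> [x Ux|v].
  by apply: differentiableV; [exact: df|exact: f0].
have CV := IHn _ f0 (Cn_onW Cf).
apply: Cn_on_ext (Cn_on_opp (Cn_on_mul (Cn_on_mul CV CV) (cf v))) => x Ux.
rewrite deriveV; [|exact: f0|exact/diff_derivable/df].
by rewrite expr2 invfM scaleNr.
Qed.

Lemma derive_sqrt_comp (f : V -> R^o) x v : 0 < f x -> differentiable f x ->
  differentiable (fun y => Num.sqrt (f y) : R^o) x /\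
  'D_v (fun y => Num.sqrt (f y) : R^o) x = 'D_v f x / (2 * Num.sqrt (f x)).
Proof.
move=> fx df; have [ds dE] := is_derive1_sqrt fx.
have ds' : differentiable (Num.sqrt : R^o -> R^o) (f x) by exact/derivable1_diffP.
have dc : differentiable (fun y => Num.sqrt (f y) : R^o) x.
  exact: (differentiable_comp df ds').
split=> //; rewrite !deriveE // [X in X v](diff_comp df ds') /= diff1E //.
by rewrite derive1E dE.
Qed.

Lemma Cn_on_sqrt n (f : V -> R^o) : (forall x, U x -> 0 < f x) ->
  Cn_on n U f -> Cn_on n U (fun x => Num.sqrt (f x) : R^o).
Proof.
move=> f0; elim: n => [|n IHn].
  move=> cf x Ux; apply: continuous_comp; [exact: cf|exact: sqrt_continuous].
move=> Cf; have [df cf] := Cf; split=> [x Ux|v].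
  by have [] := derive_sqrt_comp 0 (f0 _ Ux) (df _ Ux).
have C2 : Cn_on n U (fun x => (2 * Num.sqrt (f x))^-1 : R^o).
  apply: Cn_on_inv => [x Ux|]; first by rewrite mulf_neq0 ?gt_eqF ?sqrtr_gt0 ?f0.
  exact: Cn_on_mul (Cn_on_cst n (2 : R^o)) (IHn (Cn_onW Cf)).
apply: Cn_on_ext (Cn_on_mul (cf v) C2) => x Ux.
by have [_ ->] := derive_sqrt_comp v (f0 _ Ux) (df _ Ux).
Qed.

Lemma Cn_on_pair (W W' : normedModType R) n (f : V -> W) (g : V -> W') :
  Cn_on n U f -> Cn_on n U g -> Cn_on n U (fun x => (f x, g x)).
Proof.
elim: n f g => [|n IHn] f g.
  by move=> cf cg x Ux; apply: cvg_pair; [exact: cf|exact: cg].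
move=> [df cf] [dg cg]; split=> [x Ux|v].
  by apply: differentiable_pair; [exact: df|exact: dg].
apply: Cn_on_ext (IHn _ _ (cf v) (cg v)) => x Ux.
have dfx := df _ Ux; have dgx := dg _ Ux.
by rewrite !deriveE ?diff_pair //; exact: differentiable_pair.
Qed.

End SmoothCalculus.

Lemma scalel_linear_cont (R : realType) (W : normedModType R) (w : W) :
  exists2 L : {linear R^o -> W}, continuous L & forall x, L x = x *: w.
Proof.
have lin : linear (fun x : R^o => x *: w).
  by move=> k x y /=; rewrite scalerDl scalerA.
pose M := GRing.isLinear.Build R R^o W *:%R _ lin.
pose L : {linear R^o -> W} := HB.pack (fun x : R^o => x *: w) M.
exists L => //; exact: scalel_continuous.
Qed.

Lemma coordmx_linear_cont (R : realType) m n (i : 'I_m) (j : 'I_n) :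
  exists2 L : {linear 'M[R]_(m, n) -> R^o}, continuous L & forall A, L A = A i j.
Proof.
have lin : linear (fun A : 'M[R]_(m, n) => A i j : R^o).
  by move=> k A B /=; rewrite !mxE.
pose M := GRing.isLinear.Build R 'M[R]_(m, n) R^o *:%R _ lin.
pose L : {linear 'M[R]_(m, n) -> R^o} :=
  HB.pack (fun A : 'M[R]_(m, n) => A i j : R^o) M.
exists L => //; exact: coord_continuous.
Qed.

Section SmoothComponents.
Variables (R : realType) (V : normedModType R) (U : set V).
Hypothesis oU : open U.

Lemma Cn_on_scalel (W : normedModType R) n (f : V -> R^o) (w : W) :
  Cn_on n U f -> Cn_on n U (fun x => f x *: w).
Proof.
have [L cL LE] := scalel_linear_cont w.
by move=> Cf; apply: Cn_on_ext (Cn_on_linear oU cL Cf) => // x _ /=.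
Qed.

Lemma Cn_on_coord m p n (f : V -> 'M[R]_(m, p)) i j :
  Cn_on n U f -> Cn_on n U (fun x => f x i j : R^o).
Proof.
have [L cL LE] := coordmx_linear_cont R i j.
by move=> Cf; apply: Cn_on_ext (Cn_on_linear oU cL Cf) => // x _ /=.
Qed.

Lemma Cn_on_fst (W W' : normedModType R) n (f : V -> (W * W')%type) :
  Cn_on n U f -> Cn_on n U (fun x => (f x).1).
Proof.
by move=> Cf; apply: (@Cn_on_linear _ _ _ oU _ _ fst) Cf => x; exact: cvg_fst.
Qed.

Lemma Cn_on_snd (W W' : normedModType R) n (f : V -> (W * W')%type) :
  Cn_on n U f -> Cn_on n U (fun x => (f x).2).
Proof.
by move=> Cf; apply: (@Cn_on_linear _ _ _ oU _ _ snd) Cf => x; exact: cvg_snd.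
Qed.

Lemma Cn_on_sum (W : normedModType R) n (I : Type) (r : seq I)
    (f : I -> V -> W) :
  (forall i, Cn_on n U (f i)) -> Cn_on n U (fun x => \sum_(i <- r) f i x).
Proof.
move=> Cf; elim: r => [|i r IHr].
  by apply: Cn_on_ext (Cn_on_cst oU n 0) => // x _; rewrite big_nil.
by apply: Cn_on_ext (Cn_on_add oU (Cf i) IHr) => // x _; rewrite big_cons.
Qed.

Lemma Cn_on_mx m p n (f : V -> 'M[R]_(m, p)) :
  (forall i j, Cn_on n U (fun x => f x i j : R^o)) -> Cn_on n U f.
Proof.
move=> Cf; have C1 i j := Cn_on_scalel (delta_mx i j : 'M[R]_(m, p)) (Cf i j).
have C2 i := Cn_on_sum (index_enum _) (C1 i).
apply: Cn_on_ext (Cn_on_sum (index_enum _) C2) => // x _.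
by rewrite [RHS]matrix_sum_delta.
Qed.

End SmoothComponents.

Section DerivativesOfCurves.
Variables (R : realType) (t : R).

Lemma is_derive_linear (W W' : normedModType R) (L : {linear W -> W'})
    (f : R -> W) d :
  continuous L -> is_derive t 1 f d -> is_derive t 1 (fun s => L (f s)) (L d).
Proof.
move=> cL [df dE]; have df' : differentiable f t by exact/derivable1_diffP.
have dL : differentiable L (f t) by exact: linear_differentiable.
have dc : differentiable (L \o f) t by exact: differentiable_comp.
apply: DeriveDef; first exact: diff_derivable.
by rewrite -dE !deriveE // (diff_comp df' dL) (diff_lin _ cL).
Qed.

Lemma is_derive_fst (W W' : normedModType R) (f : R -> (W * W')%type) d :
  is_derive t 1 f d -> is_derive t 1 (fun s => (f s).1) d.1.
Proof. by apply: (@is_derive_linear _ _ fst) => x; exact: cvg_fst. Qed.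

Lemma is_derive_snd (W W' : normedModType R) (f : R -> (W * W')%type) d :
  is_derive t 1 f d -> is_derive t 1 (fun s => (f s).2) d.2.
Proof. by apply: (@is_derive_linear _ _ snd) => x; exact: cvg_snd. Qed.

Lemma is_derive_coord m p (f : R -> 'M[R]_(m, p)) d i j :
  is_derive t 1 f d -> is_derive t 1 (fun s => f s i j : R^o) (d i j).
Proof.
have [L cL LE] := coordmx_linear_cont R i j.
by move=> /(is_derive_linear cL); rewrite LE; under eq_fun do rewrite LE.
Qed.

Lemma is_derive_mx m p (f : R -> 'M[R]_(m, p)) (d : 'M[R]_(m, p)) :
  (forall i j, is_derive t 1 (fun s => f s i j : R^o) (d i j)) ->
  is_derive t 1 f d.
Proof.
move=> df; have h : derivable f t 1 by apply/derivable_mxP => i j; case: (df i j).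
apply: DeriveDef => //; rewrite derive_mx //; apply/matrixP => i j.
by rewrite mxE; case: (df i j).
Qed.

Lemma is_derive_pair (W W' : normedModType R) (f : R -> W) (g : R -> W') d e :
  is_derive t 1 f d -> is_derive t 1 g e ->
  is_derive t 1 (fun s => (f s, g s)) (d, e).
Proof.
move=> [df <-] [dg <-].
have df' : differentiable f t by exact/derivable1_diffP.
have dg' : differentiable g t by exact/derivable1_diffP.
have dp := differentiable_pair df' dg'.
apply: DeriveDef; first exact: diff_derivable.
by rewrite !deriveE // diff_pair.
Qed.

Lemma is_derive_add (W : normedModType R) (f g : R -> W) d e :
  is_derive t 1 f d -> is_derive t 1 g e ->
  is_derive t 1 (fun s => f s + g s) (d + e).
Proof. exact: is_deriveD. Qed.

Lemma is_derive_sub (W : normedModType R) (f g : R -> W) d e :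
  is_derive t 1 f d -> is_derive t 1 g e ->
  is_derive t 1 (fun s => f s - g s) (d - e).
Proof. exact: is_deriveB. Qed.

Lemma is_derive_mul (f g : R -> R^o) (d e : R) :
  is_derive t 1 f d -> is_derive t 1 g e ->
  is_derive t 1 (fun s => f s * g s : R^o) (f t * e + g t * d).
Proof. exact: is_deriveM. Qed.

Lemma is_derive_inv (f : R -> R^o) (d : R) : f t != 0 ->
  is_derive t 1 f d ->
  is_derive t 1 (fun s => (f s)^-1 : R^o) (- (f t) ^- 2 * d).
Proof.
move=> f0 [df <-]; apply: DeriveDef; first exact: derivableV.
by rewrite deriveV.
Qed.

Lemma is_derive_sqrt (f : R -> R^o) (d : R) : 0 < f t ->
  is_derive t 1 f d ->
  is_derive t 1 (fun s => Num.sqrt (f s) : R^o) (d / (2 * Num.sqrt (f t))).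
Proof.
move=> f0 [df <-]; have df' : differentiable f t by exact/derivable1_diffP.
have [ds dE] := derive_sqrt_comp (1 : R^o) f0 df'.
by apply: DeriveDef; [exact: diff_derivable|].
Qed.

Lemma is_derive_near_cst (W : normedModType R) (f : R -> W) (w d : W) (J : set R) :
  open J -> J t -> (forall s, J s -> f s = w) -> is_derive t 1 f d -> d = 0.
Proof.
move=> oJ Jt fw [_ <-].
rewrite -[RHS](derive_cst w (t : R^o) 1); apply: near_eq_derive.
by apply: filterS (open_nbhs_nbhs (conj oJ Jt)).
Qed.

End DerivativesOfCurves.

Lemma is_derive1E (R : realType) (W : normedModType R) (f : R -> W) (t : R) d :
  is_derive t 1 f d -> derive1 f t = d.
Proof. by rewrite derive1E => -[]. Qed.

Lemma smooth_curve_is_derive (R : realType) (V : normedModType R) (M : set V)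
    (p : V) (c : R -> V) :
  smooth_curve M p c -> is_derive (0 : R) 1 c (derive1 c 0).
Proof.
move=> [_ [J [oJ J0 /(_ 1%N)[dc _] _]]]; rewrite derive1E.
by apply: DeriveDef => //; apply: diff_derivable; exact: dc.
Qed.

(** * Rank-one projections in Bloch coordinates *)

Lemma trace2 (K : pzRingType) (A : 'M[K]_2) : \tr A = A 0 0 + A 1 1.
Proof.
rewrite /mxtrace big_ord_recr big_ord1 /=.
by congr (A _ _ + A _ _); apply/val_inj.
Qed.

Lemma mulmx2 (K : pzRingType) (A B : 'M[K]_2) i j :
  (A *m B) i j = A i 0 * B 0 j + A i 1 * B 1 j.
Proof.
rewrite mxE big_ord_recr big_ord1 /=.
by congr (A _ _ * B _ _ + A _ _ * B _ _); apply/val_inj.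
Qed.

Lemma mx2P (K : Type) (A B : 'M[K]_2) :
  A 0 0 = B 0 0 -> A 0 1 = B 0 1 -> A 1 0 = B 1 0 -> A 1 1 = B 1 1 -> A = B.
Proof.
move=> h00 h01 h10 h11; apply/matrixP => i j.
have I2 (k : 'I_2) : k = 0 \/ k = 1.
  by case: k => [[|[|//]] ?]; [left|right]; apply/val_inj.
by case: (I2 i) => ->; case: (I2 j) => ->.
Qed.

Lemma addmxE (K : nmodType) m n (A B : 'M[K]_(m, n)) i j :
  (A + B) i j = A i j + B i j.
Proof. exact: mxE. Qed.

Lemma oppmxE (K : zmodType) m n (A : 'M[K]_(m, n)) i j : (- A) i j = - A i j.
Proof. exact: mxE. Qed.

Definition mx2E := (addmxE, oppmxE, mulmx2, trace2).

Section Complex2x2.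
Local Open Scope sesquilinear_scope.
Variable R : realType.
Implicit Types A B q : realM2 R.

Definition cmul A B : realM2 R :=
  (A.1 *m B.1 - A.2 *m B.2, A.1 *m B.2 + A.2 *m B.1).
Definition cadj A : realM2 R := (A.1^T, - A.2^T).

Lemma cmatE A i j : cmat A i j = (A.1 i j +i* A.2 i j)%C.
Proof. exact: mxE. Qed.

Lemma cmat_mul A B : cmat A *m cmat B = cmat (cmul A B).
Proof.
by apply/matrixP => i j; rewrite mulmx2 !cmatE /= !mx2E; simpc; congr Complex; ring.
Qed.

Lemma cmat_adj A : (cmat A)^t* = cmat (cadj A).
Proof. by apply/matrixP => i j; rewrite !mxE. Qed.

Lemma cmatD A B : cmat (A + B) = cmat A + cmat B.
Proof. by apply/matrixP => i j; rewrite !mxE. Qed.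

Lemma cmatZ (t : R) A : cmat (t *: A) = (t%:C)%C *: cmat A.
Proof. by apply/matrixP => i j; rewrite !mxE /=; simpc. Qed.

Lemma tr_cmat A : \tr (cmat A) = (\tr A.1 +i* \tr A.2)%C.
Proof. by rewrite !trace2 !mxE. Qed.

Lemma cmat_inj : injective (@cmat R).
Proof.
move=> [A1 A2] [B1 B2] /matrixP h; congr pair; apply/matrixP => i j;
  by have := h i j; rewrite !mxE => -[].
Qed.

Definition uncmat (M : 'M[R[i]]_2) : realM2 R :=
  (map_mx (@complex.Re R) M, map_mx (@complex.Im R) M).

Lemma uncmatK : cancel uncmat (@cmat R).
Proof. by move=> M; apply/matrixP => i j; rewrite !mxE; case: (M i j). Qed.

Definition vec3 (a b c : R) : 'rV[R]_3 := \row_k [:: a; b; c]`_k.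

Lemma dotr_vec3 a b c a' b' c' :
  dotr (vec3 a b c) (vec3 a' b' c') = a * a' + b * b' + c * c'.
Proof. by rewrite /dotr !big_ord_recr big_ord0 /= !mxE /= add0r. Qed.

Lemma vec3P (x : 'rV[R]_3) : exists a b c, x = vec3 a b c.
Proof.
exists (x 0 (inord 0)), (x 0 (inord 1)), (x 0 (inord 2)).
apply/rowP => k; rewrite mxE.
by case: k => [[|[|[|//]]] ?] /=; congr (x 0 _); apply/val_inj; rewrite /= inordK.
Qed.

Lemma vec3D a b c a' b' c' :
  vec3 a b c + vec3 a' b' c' = vec3 (a + a') (b + b') (c + c').
Proof. by apply/rowP => -[[|[|[|//]]] ?]; rewrite !mxE. Qed.

Lemma vec3Z k a b c : k *: vec3 a b c = vec3 (k * a) (k * b) (k * c).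
Proof. by apply/rowP => -[[|[|[|//]]] ?]; rewrite !mxE. Qed.

Lemma dotrC (x y : 'rV[R]_3) : dotr x y = dotr y x.
Proof. by rewrite /dotr; apply: eq_bigr => k _; rewrite mulrC. Qed.

Lemma dotrDl (x y z : 'rV[R]_3) : dotr (x + y) z = dotr x z + dotr y z.
Proof. by rewrite /dotr -big_split; apply: eq_bigr => k _; rewrite mxE mulrDl. Qed.

Lemma dotrZl k (x y : 'rV[R]_3) : dotr (k *: x) y = k * dotr x y.
Proof. by rewrite /dotr mulr_sumr; apply: eq_bigr => i _; rewrite mxE mulrA. Qed.

Lemma dotrDr (x y z : 'rV[R]_3) : dotr z (x + y) = dotr z x + dotr z y.
Proof. by rewrite ![dotr z _]dotrC dotrDl. Qed.

Lemma dotrZr k (x y : 'rV[R]_3) : dotr y (k *: x) = k * dotr y x.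
Proof. by rewrite ![dotr y _]dotrC dotrZl. Qed.

Lemma dotr_ge0 (x : 'rV[R]_3) : 0 <= dotr x x.
Proof. by apply: sumr_ge0 => k _; rewrite -expr2 sqr_ge0. Qed.

Lemma dotr_eq0 (x : 'rV[R]_3) : dotr x x = 0 -> x = 0.
Proof.
move=> /eqP; rewrite psumr_eq0 => [|k _]; last by rewrite -expr2 sqr_ge0.
move=> /allP h; apply/rowP => k; rewrite mxE; apply/eqP.
by have := h k (mem_index_enum _); rewrite mulf_eq0 orbb.
Qed.

Lemma dotr_CauchySchwarz (x y : 'rV[R]_3) :
  dotr x y ^+ 2 <= dotr x x * dotr y y.
Proof.
have [[a [b [c ->]]] [a' [b' [c' ->]]]] := (vec3P x, vec3P y).
rewrite !dotr_vec3 -subr_ge0.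
have -> : (a * a + b * b + c * c) * (a' * a' + b' * b' + c' * c') -
    (a * a' + b * b' + c * c') ^+ 2 =
  (a * b' - b * a') ^+ 2 + (a * c' - c * a') ^+ 2 + (b * c' - c * b') ^+ 2 by ring.
by rewrite !addr_ge0 ?sqr_ge0.
Qed.

(* The Bloch coordinates: q = (tr q + (re3 q + i im3 q) . sigma) / 2, with
   sigma the Pauli matrices. *)
Definition re3 q : 'rV[R]_3 :=
  vec3 (q.1 0 1 + q.1 1 0) (q.2 1 0 - q.2 0 1) (q.1 0 0 - q.1 1 1).
Definition im3 q : 'rV[R]_3 :=
  vec3 (q.2 0 1 + q.2 1 0) (q.1 0 1 - q.1 1 0) (q.2 0 0 - q.2 1 1).

Lemma proj1_spaceE q : proj1_space R q <->
  [/\ \tr q.1 = 1, \tr q.2 = 0, dotr (re3 q) (re3 q) = 1 + dotr (im3 q) (im3 q)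
    & dotr (re3 q) (im3 q) = 0].
Proof.
rewrite /proj1_space /= cmat_mul tr_cmat !dotr_vec3 !trace2.
case: q => P Q /=; split.
  move=> [/cmat_inj [hP hQ] [tP tQ]].
  have e00 := congr1 (fun A : 'M[R]_2 => A 0 0) hP.
  have f00 := congr1 (fun A : 'M[R]_2 => A 0 0) hQ.
  rewrite /= !mx2E in e00 f00.
  have t1 : P 1 1 = 1 - P 0 0 by rewrite -tP; ring.
  have t2 : Q 1 1 = - Q 0 0 by apply/eqP; rewrite -addr_eq0 addrC tQ.
  split=> //; rewrite t1 t2.
    by move: e00; lra.
  by move: f00; lra.
move=> [tP tQ e0 e1].
have t1 : P 1 1 = 1 - P 0 0 by rewrite -tP; ring.
have t2 : Q 1 1 = - Q 0 0 by apply/eqP; rewrite -addr_eq0 addrC tQ.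
rewrite t1 t2 in e0 e1.
split; last by rewrite tP tQ.
congr cmat; congr pair; apply: mx2P; rewrite !mx2E.
all: move: e0 e1; rewrite ?t1 ?t2; lra.
Qed.

Lemma proj1_tangent_tr q A : proj1_space R q -> proj1_tangent q A ->
  \tr (cmat A) = 0.
Proof.
rewrite /proj1_space /proj1_tangent /=; move: (cmat q) (cmat A) => M N [MM _] h.
have MNM : M *m N *m M = 0.
  have := congr1 (mulmx M) h; rewrite mulmxDr !mulmxA MM.
  by move/eqP; rewrite -subr_eq0 addrC addrA addNr add0r => /eqP.
have MN0 : \tr (M *m N) = 0 by rewrite -MM -mulmxA mxtrace_mulC MNM mxtrace0.
by rewrite -h mxtraceD [\tr (N *m M)]mxtrace_mulC MN0 addr0.
Qed.

Lemma proj1_tangentE q A : proj1_space R q -> (proj1_tangent q A <->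
  [/\ \tr A.1 = 0, \tr A.2 = 0, dotr (re3 q) (re3 A) = dotr (im3 q) (im3 A)
    & dotr (re3 q) (im3 A) + dotr (im3 q) (re3 A) = 0]).
Proof.
move=> Xq; split.
  move=> TA; have := proj1_tangent_tr Xq TA; rewrite tr_cmat => -[tA tB].
  move: TA Xq => + /proj1_spaceE[tP tQ _ _].
  rewrite /proj1_tangent /= !cmat_mul -cmatD => /cmat_inj.
  move: tA tB tP tQ; rewrite !dotr_vec3; case: A q => [A B] [P Q] /=.
  rewrite !trace2 => tA tB tP tQ [hP hQ].
  have e00 := congr1 (fun A : 'M[R]_2 => A 0 0) hP.
  have f00 := congr1 (fun A : 'M[R]_2 => A 0 0) hQ.
  rewrite /= !mx2E in e00 f00.
  have t1 : P 1 1 = 1 - P 0 0 by rewrite -tP; ring.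
  have t2 : Q 1 1 = - Q 0 0 by apply/eqP; rewrite -addr_eq0 addrC tQ.
  have t3 : A 1 1 = - A 0 0 by apply/eqP; rewrite -addr_eq0 addrC tA.
  have t4 : B 1 1 = - B 0 0 by apply/eqP; rewrite -addr_eq0 addrC tB.
  by split=> //; rewrite t1 t2 t3 t4; move: e00 f00; lra.
move: Xq => /proj1_spaceE[+ + _ _]; rewrite /proj1_tangent /= !cmat_mul -cmatD.
rewrite !dotr_vec3; case: A q => [A B] [P Q] /=.
rewrite !trace2 => tP tQ [tA tB e0 e1].
have t1 : P 1 1 = 1 - P 0 0 by rewrite -tP; ring.
have t2 : Q 1 1 = - Q 0 0 by apply/eqP; rewrite -addr_eq0 addrC tQ.
have t3 : A 1 1 = - A 0 0 by apply/eqP; rewrite -addr_eq0 addrC tA.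
have t4 : B 1 1 = - B 0 0 by apply/eqP; rewrite -addr_eq0 addrC tB.
congr cmat; congr pair; apply: mx2P; rewrite /= !mx2E.
all: move: e0 e1; rewrite ?t1 ?t2 ?t3 ?t4; lra.
Qed.

Lemma hsnorm_proj1 q : proj1_space R q ->
  hsnorm (cmat q) = Num.sqrt (dotr (re3 q) (re3 q)).
Proof.
rewrite /hsnorm cmat_adj cmat_mul tr_cmat /= => /proj1_spaceE[].
rewrite !dotr_vec3; case: q => [P Q] /=.
rewrite !trace2 !mx2E !mxE => tP tQ e0 e1; congr Num.sqrt.
have t1 : P 1 1 = 1 - P 0 0 by rewrite -tP; ring.
have t2 : Q 1 1 = - Q 0 0 by apply/eqP; rewrite -addr_eq0 addrC tQ.
by move: e0 e1; rewrite t1 t2; lra.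
Qed.

(* |re3 q| is the Hilbert-Schmidt norm of a projection q. *)
Definition bloch_metric q A B : R :=
  let n := Num.sqrt (dotr (re3 q) (re3 q)) in
  (dotr (re3 A) (re3 B) + dotr (im3 A) (im3 B)) / n
  - (dotr (re3 A) (re3 q) * dotr (re3 B) (re3 q)
     + dotr (re3 A) (im3 q) * dotr (re3 B) (im3 q)) / n ^+ 3.

Lemma proj1_metricE q A B : proj1_space R q ->
  proj1_tangent q A -> proj1_tangent q B ->
  proj1_metric q A B = bloch_metric q A B.
Proof.
move=> Xq /(proj1_tangentE _ Xq)[tA tA' eA fA] /(proj1_tangentE _ Xq)[tB tB' eB fB].
rewrite /proj1_metric /bloch_metric (hsnorm_proj1 Xq) !cmat_adj !cmat_mul !tr_cmat.
move: Xq => /proj1_spaceE[tq tq' _ _].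
set n := Num.sqrt _.
set t1 := \tr _; set t2 := \tr _; set s1 := \tr _; set s2 := \tr _.
set u1 := \tr _; set u2 := \tr _.
have [t1E s1E s2E u1E u2E] :
  [/\ 2 * t1 = dotr (re3 A) (re3 B) + dotr (im3 A) (im3 B),
    s1 = dotr (re3 A) (re3 q), s2 = dotr (re3 A) (im3 q),
    u1 = dotr (re3 B) (re3 q) & u2 = - dotr (re3 B) (im3 q)].
  rewrite /t1 /s1 /s2 /u1 /u2; move: tA tA' eA fA tB tB' eB fB tq tq'.
  rewrite !dotr_vec3; case: A B q {t1 t2 s1 s2 u1 u2 n} => [A A'] [B B'] [P Q] /=.
  rewrite !trace2 !mx2E ![_^T _ _]mxE => tA tA' eA fA tB tB' eB fB tq tq'.
  have a1 : A 1 1 = - A 0 0 by apply/eqP; rewrite -addr_eq0 addrC tA.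
  have a2 : A' 1 1 = - A' 0 0 by apply/eqP; rewrite -addr_eq0 addrC tA'.
  have b1 : B 1 1 = - B 0 0 by apply/eqP; rewrite -addr_eq0 addrC tB.
  have b2 : B' 1 1 = - B' 0 0 by apply/eqP; rewrite -addr_eq0 addrC tB'.
  have p1 : P 1 1 = 1 - P 0 0 by rewrite -tq; ring.
  have q1 : Q 1 1 = - Q 0 0 by apply/eqP; rewrite -addr_eq0 addrC tq'.
  rewrite a1 a2 p1 q1 in eA fA; rewrite b1 b2 p1 q1 in eB fB.
  rewrite a1 a2 b1 b2 p1 q1; split; move: eA fA eB fB; lra.
rewrite -t1E -s1E -s2E -u1E -[dotr (re3 B) (im3 q)]opprK -u2E.
simpc => /=; ring.
Qed.

Lemma re3_proj1_gt0 q : proj1_space R q -> 0 < dotr (re3 q) (re3 q).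
Proof. by case/proj1_spaceE => _ _ -> _; rewrite ltr_pwDl ?dotr_ge0. Qed.

Lemma bloch_metric_gt0 q A : proj1_space R q -> proj1_tangent q A -> A != 0 ->
  0 < bloch_metric q A A.
Proof.
move=> Xq /(proj1_tangentE _ Xq)[tA tA' eA fA] A0.
have xx := re3_proj1_gt0 Xq; case/proj1_spaceE : Xq => _ _ xy _.
rewrite /bloch_metric; set n := Num.sqrt _.
have n0 : 0 < n by rewrite sqrtr_gt0.
have nn : n ^+ 2 = dotr (re3 q) (re3 q) by rewrite sqr_sqrtr ?ltW.
have -> : forall u v : R, u / n - v / n ^+ 3 = (u * n ^+ 2 - v) / n ^+ 3.
  by move=> u v; field; rewrite gt_eqF.
rewrite divr_gt0 ?exprn_gt0 // nn xy subr_gt0.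
have pos : 0 < dotr (re3 A) (re3 A) + dotr (im3 A) (im3 A).
  rewrite lt_neqAle addr_ge0 ?dotr_ge0 // andbT eq_sym; apply: contra A0.
  rewrite paddr_eq0 ?dotr_ge0 // => /andP[/eqP/dotr_eq0 r0 /eqP/dotr_eq0 i0].
  move: tA tA' r0 i0; rewrite !trace2 /re3 /im3 => tA tA'.
  move=> /rowP r0 /rowP i0.
  have := r0 (inord 0); have := r0 (inord 1); have := r0 (inord 2).
  have := i0 (inord 0); have := i0 (inord 1); have := i0 (inord 2).
  rewrite !mxE !inordK //=; case: A tA tA' {eA fA r0 i0} => [A B] /= tA tA'.
  move=> *; apply/eqP; congr pair; apply: mx2P; rewrite !mxE; lra.
have cs1 := dotr_CauchySchwarz (re3 A) (im3 q).
have cs2 := dotr_CauchySchwarz (im3 A) (im3 q).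
have -> : dotr (re3 A) (re3 q) = dotr (im3 A) (im3 q).
  by rewrite dotrC eA dotrC.
rewrite -!expr2; apply: le_lt_trans (lerD cs2 cs1) _; rewrite mulrDr mulr1.
by rewrite addrC -mulrDl ltrDr.
Qed.

Lemma bloch_metricC q A B : bloch_metric q A B = bloch_metric q B A.
Proof.
rewrite /bloch_metric [dotr (re3 A) (re3 B)]dotrC [dotr (im3 A) (im3 B)]dotrC.
by rewrite [_ * dotr (re3 B) (re3 q)]mulrC [_ * dotr (re3 B) (im3 q)]mulrC.
Qed.

Lemma re3_linear : linear re3.
Proof. by move=> k A B; rewrite /re3 vec3Z vec3D !mxE; congr vec3; ring. Qed.

Lemma im3_linear : linear im3.
Proof. by move=> k A B; rewrite /im3 vec3Z vec3D !mxE; congr vec3; ring. Qed.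

Lemma bloch_metric_linearl q u v w k :
  bloch_metric q (k *: u + v) w = k * bloch_metric q u w + bloch_metric q v w.
Proof. by rewrite /bloch_metric re3_linear im3_linear !dotrDl !dotrZl; ring. Qed.

Lemma proj1_tangent_linear q u v k : proj1_tangent q u -> proj1_tangent q v ->
  proj1_tangent q (k *: u + v).
Proof.
rewrite /proj1_tangent /= cmatD cmatZ => hu hv.
by rewrite mulmxDl mulmxDr -scalemxAl -scalemxAr addrACA -scalerDr hu hv.
Qed.

(* The curve (1+tN)(1-tN')q(1+tN')(1-tN) with N = (1-q)Aq and N' = qA(1-q);
   it consists of conjugates of q because N and N' square to zero. *)
Lemma proj1_curve q A : proj1_space R q -> proj1_tangent q A ->
  exists v w : realM2 R, forall t : R,
    proj1_space R (q + t *: A + t ^+ 2 *: v + t ^+ 3 *: w).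
Proof.
move=> [qq tq] TA; have MNM : cmat q *m cmat A *m cmat q = 0.
  have := congr1 (mulmx (cmat q)) TA; rewrite mulmxDr !mulmxA qq.
  by move/eqP; rewrite -subr_eq0 addrC addrA addNr add0r => /eqP.
move: TA MNM qq tq; rewrite /proj1_tangent /= !mulmxE.
set M := cmat q; set N := cmat A => TA MNM qq tq.
pose P : 'M[R[i]]_2 := N * M; pose Q : 'M[R[i]]_2 := M * N.
have NE : N = P + Q by rewrite addrC.
have [Pq qP Qq qQ] : [/\ P * M = P, M * P = 0, Q * M = 0 & M * Q = Q].
  by rewrite /P /Q; split; rewrite // -?mulrA ?qq // mulrA ?qq.
have [PP QQ] : P * P = 0 /\ Q * Q = 0.
  by split; [rewrite {1}/P -mulrA qP mulr0|rewrite {2}/Q mulrA Qq mul0r].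
exists (uncmat (P * Q - Q * P)), (uncmat (- (P * Q * P))) => t.
rewrite /proj1_space /= !cmatD !cmatZ !uncmatK !mulmxE -/M -/N NE.
set s := (t%:C)%C.
have -> : (t ^+ 2)%:C%C = s ^+ 2 by rewrite rmorphXn.
have -> : (t ^+ 3)%:C%C = s ^+ 3 by rewrite rmorphXn.
pose S : 'M[R[i]]_2 := (1 + s *: P) * (1 - s *: Q).
pose S' : 'M[R[i]]_2 := (1 + s *: Q) * (1 - s *: P).
have K (X : 'M[R[i]]_2) : X * X = 0 -> (1 + s *: X) * (1 - s *: X) = 1.
  move=> XX; rewrite mulrDl mul1r mulrBr mulr1 -scalerAr -scalerAl XX.
  by rewrite !scaler0 subr0 subrK.
have K' (X : 'M[R[i]]_2) : X * X = 0 -> (1 - s *: X) * (1 + s *: X) = 1.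
  move=> XX; rewrite mulrBl mul1r mulrDr mulr1 -scalerAr -scalerAl XX.
  by rewrite !scaler0 addr0 addrK.
have S'S : S' * S = 1.
  by rewrite /S /S' mulrA -[X in X * _]mulrA K' // mulr1 K.
have -> : M + s *: (P + Q) + s ^+ 2 *: (P * Q - Q * P) + s ^+ 3 *: - (P * Q * P) =
    S * M * S'.
  have -> : S * M = M + s *: P.
    rewrite /S -mulrA mulrBl mul1r -scalerAl Qq scaler0 subr0.
    by rewrite mulrDl mul1r -scalerAl Pq.
  rewrite /S' [RHS]mulrA [(M + _) * (1 + _)]mulrDr mulr1 -scalerAr.
  rewrite [(M + _) * Q]mulrDl qQ -scalerAl.
  rewrite mulrBr mulr1 -scalerAr !mulrDl -!scalerAl qP PP mulrDl -!scalerAl.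
  rewrite !scaler0.
  move: (P * Q * P) (P * Q) (Q * P) (P) (Q) (M) => X1 X2 X3 X4 X5 X6.
  by apply/matrixP => i j; rewrite !mxE; ring.
clearbody S S' M; split; last by rewrite mxtrace_mulC mulmxE mulrA S'S mul1r.
by rewrite -!mulrA (mulrA S' S) S'S mul1r (mulrA M M) qq.
Qed.

End Complex2x2.

Section Vec3Calculus.
Variable R : realType.

Section Cn.
Variables (V : normedModType R) (U : set V).
Hypothesis oU : open U.

Lemma Cn_on_vec3 n (a b c : V -> R^o) :
  Cn_on n U a -> Cn_on n U b -> Cn_on n U c ->
  Cn_on n U (fun x => vec3 (a x) (b x) (c x)).
Proof.
move=> Ca Cb Cc; apply: Cn_on_mx => // i -[[|[|[|//]]] ?];
  [move: Ca|move: Cb|move: Cc]; by apply: Cn_on_ext => // x _; rewrite mxE.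
Qed.

Lemma Cn_on_dotr n (f g : V -> 'rV[R]_3) :
  Cn_on n U f -> Cn_on n U g -> Cn_on n U (fun x => dotr (f x) (g x) : R^o).
Proof.
move=> Cf Cg; apply: Cn_on_sum => // k.
by apply: Cn_on_mul => //; apply: Cn_on_coord.
Qed.

Lemma Cn_on_sub n (f g : V -> R^o) :
  Cn_on n U f -> Cn_on n U g -> Cn_on n U (fun x => f x - g x : R^o).
Proof. by move=> Cf Cg; apply: Cn_on_add => //; apply: Cn_on_opp. Qed.

Lemma Cn_on_re3 n (f : V -> realM2 R) :
  Cn_on n U f -> Cn_on n U (fun x => re3 (f x)).
Proof.
move=> Cf; have C1 := Cn_on_fst oU Cf; have C2 := Cn_on_snd oU Cf.
apply: Cn_on_vec3.
- by apply: Cn_on_add; rewrite //; apply: Cn_on_coord.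
- by apply: Cn_on_sub; rewrite //; apply: Cn_on_coord.
- by apply: Cn_on_sub; rewrite //; apply: Cn_on_coord.
Qed.

Lemma Cn_on_im3 n (f : V -> realM2 R) :
  Cn_on n U f -> Cn_on n U (fun x => im3 (f x)).
Proof.
move=> Cf; have C1 := Cn_on_fst oU Cf; have C2 := Cn_on_snd oU Cf.
apply: Cn_on_vec3.
- by apply: Cn_on_add; rewrite //; apply: Cn_on_coord.
- by apply: Cn_on_sub; rewrite //; apply: Cn_on_coord.
- by apply: Cn_on_sub; rewrite //; apply: Cn_on_coord.
Qed.

Lemma Cn_on_scale3 n (k : V -> R^o) (f : V -> 'rV[R]_3) :
  Cn_on n U k -> Cn_on n U f -> Cn_on n U (fun x => k x *: f x).
Proof.
move=> Ck Cf; apply: Cn_on_mx => // i j.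
apply: (Cn_on_ext oU) (Cn_on_mul oU Ck (Cn_on_coord oU i j Cf)) => x _.
by rewrite mxE.
Qed.

End Cn.

Section IsDerive.
Variable t : R.

Lemma is_derive_vec3 (a b c : R -> R^o) (a' b' c' : R) :
  is_derive t 1 a a' -> is_derive t 1 b b' -> is_derive t 1 c c' ->
  is_derive t 1 (fun s => vec3 (a s) (b s) (c s)) (vec3 a' b' c').
Proof.
move=> da db dc; apply: is_derive_mx => i -[[|[|[|//]]] ?]; rewrite mxE /=;
  by under eq_fun do rewrite mxE /=.
Qed.

Lemma is_derive_re3 (c : R -> realM2 R) d : is_derive t 1 c d ->
  is_derive t 1 (fun s => re3 (c s)) (re3 d).
Proof.
move=> dc; have d1 := is_derive_fst dc; have d2 := is_derive_snd dc.
by apply: is_derive_vec3; [apply: is_derive_add|apply: is_derive_sub..];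
  apply: is_derive_coord.
Qed.

Lemma is_derive_im3 (c : R -> realM2 R) d : is_derive t 1 c d ->
  is_derive t 1 (fun s => im3 (c s)) (im3 d).
Proof.
move=> dc; have d1 := is_derive_fst dc; have d2 := is_derive_snd dc.
by apply: is_derive_vec3; [apply: is_derive_add|apply: is_derive_sub..];
  apply: is_derive_coord.
Qed.

Lemma is_derive_scale3 (k : R -> R^o) (f : R -> 'rV[R]_3) (dk : R) d :
  is_derive t 1 k dk -> is_derive t 1 f d ->
  is_derive t 1 (fun s => k s *: f s) (k t *: d + dk *: f t).
Proof.
move=> hk hf; apply: is_derive_mx => i j; rewrite !mxE.
under eq_fun do rewrite mxE.
rewrite [dk * _]mulrC; apply: is_derive_mul => //; exact: is_derive_coord.
Qed.

Lemma is_derive_dotr (f g : R -> 'rV[R]_3) d e :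
  is_derive t 1 f d -> is_derive t 1 g e ->
  is_derive t 1 (fun s => dotr (f s) (g s) : R^o) (dotr (f t) e + dotr (g t) d).
Proof.
move=> hf hg.
have hk k := is_derive_mul (is_derive_coord 0 k hf) (is_derive_coord 0 k hg).
have -> : (fun s => dotr (f s) (g s)) = \sum_k (fun s => f s 0 k * g s 0 k : R^o).
  by apply/funext => s; rewrite fct_sumE.
rewrite /dotr -big_split; exact: is_derive_sum.
Qed.

End IsDerive.
End Vec3Calculus.

Section Proj1.
Variable R : realType.
Implicit Types q A B : realM2 R.

Lemma tangent_proj1 q : proj1_space R q ->
  tangent (proj1_space R) q = proj1_tangent q.
Proof.
move=> Xq; rewrite eqEsubset; split=> A.
  move=> [c Cc ->]; have dc := smooth_curve_is_derive Cc.
  case: Cc => c0 [J [oJ J0 _ cJ]].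
  have dr := is_derive_re3 dc; have di := is_derive_im3 dc.
  have d1 := is_derive_fst dc; have d2 := is_derive_snd dc.
  have cst0 (W : normedModType R) f (w : W) d :
      (forall q, proj1_space R q -> f q = w) ->
      is_derive (0 : R) 1 (fun s => f (c s)) d -> d = 0.
    by move=> fw; apply: (is_derive_near_cst (w := w) oJ J0) => s /cJ /fw.
  apply/proj1_tangentE => //; split.
  - apply: (cst0 R^o (fun q => \tr q.1) 1); first by move=> p /proj1_spaceE[].
    rewrite trace2; under eq_fun do rewrite trace2.
    by apply: is_derive_add; exact: is_derive_coord.
  - apply: (cst0 R^o (fun q => \tr q.2) 0); first by move=> p /proj1_spaceE[].
    rewrite trace2; under eq_fun do rewrite trace2.
    by apply: is_derive_add; exact: is_derive_coord.
  - have := cst0 R^o (fun q => dotr (re3 q) (re3 q) - dotr (im3 q) (im3 q)) 1 _ _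
      (is_derive_sub (is_derive_dotr dr dr) (is_derive_dotr di di)).
    rewrite c0 => h; have {}h := h _.
    suff : forall a b : R, a + a - (b + b) = 0 -> a = b.
      by apply; apply: h => p /proj1_spaceE[_ _ -> _]; rewrite addrK.
    by move=> a b; lra.
  - have := cst0 R^o (fun q => dotr (re3 q) (im3 q)) 0 _ _ (is_derive_dotr dr di).
    by rewrite c0; apply => p /proj1_spaceE[].
move=> TA; have [v [w cX]] := proj1_curve Xq TA.
pose c t := q + t *: A + t ^+ 2 *: v + t ^+ 3 *: w.
have Ct n : Cn_on n setT (id : R^o -> R^o) by exact: Cn_on_id openT n.
exists c.
  split; first by rewrite /c !expr0n /= !scale0r !addr0.
  exists setT; split=> //; [exact: openT| |by move=> t _; exact: cX].
  move=> n; rewrite /c; have oT : open (setT : set R^o) := openT.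
  have CX k : Cn_on n (setT : set R^o) (fun t : R^o => t ^+ k : R^o).
    elim: k => [|k IHk]; first exact: Cn_on_cst.
    apply: (Cn_on_ext oT) (Cn_on_mul oT (Ct n) IHk) => t _.
    by rewrite exprS.
  apply: Cn_on_add => //; last exact: Cn_on_scalel.
  apply: Cn_on_add => //; last exact: Cn_on_scalel.
  apply: Cn_on_add => //; last exact: Cn_on_scalel.
  exact: Cn_on_cst.
have dscale (W : normedModType R) (f : R -> R^o) (d : R) (u : W) :
    is_derive (0 : R) 1 f d -> is_derive (0 : R) 1 (fun t => f t *: u) (d *: u).
  have [L cL LE] := scalel_linear_cont u => hf.
  by have := is_derive_linear cL hf; rewrite LE; under eq_fun do rewrite LE.
have d1 : is_derive (0 : R) 1 (id : R -> R^o) 1 by exact: is_derive_id.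
have XS k : (fun t : R => t ^+ k.+1 : R^o) = (fun t : R => t ^+ k * t : R^o).
  by apply/funext => t; rewrite exprSr.
have dX k : exists d : R, is_derive (0 : R) 1 (fun t : R => t ^+ k : R^o) d.
  elim: k => [|k [d IHk]]; first by exists 0; exact: is_derive_cst.
  by rewrite XS; eexists; exact: is_derive_mul IHk d1.
have {}dX k : is_derive (0 : R) 1 (fun t : R => t ^+ k.+2 : R^o) 0.
  have [d dk] := dX k.+1; rewrite XS; apply: is_derive_eq (is_derive_mul dk d1) _.
  by rewrite expr0n /= !mul0r addr0.
have : is_derive (0 : R) 1 c (0 + 1 *: A + 0 *: v + 0 *: w).
  exact (is_derive_add (is_derive_add (is_derive_add (is_derive_cst q (0 : R) (1 : R))
    (dscale _ _ _ A d1)) (dscale _ _ _ v (dX 0%N))) (dscale _ _ _ w (dX 1%N))).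
by move=> -[_ dE]; rewrite derive1E dE !scale0r scale1r add0r !addr0.
Qed.

Lemma open_pos (V : normedModType R) (f : V -> R^o) :
  Cn_on 0 setT f -> open [set x | 0 < f x].
Proof.
move=> cf; apply: (@open_comp V R^o f [set y | 0 < y]) => [x _|]; first exact: cf.
exact: open_gt.
Qed.

Lemma proj1_metric_riemannian : riemannian_metric (proj1_space R) (@proj1_metric R).
Proof.
split.
- move=> p u v w k Xp; rewrite tangent_proj1 // => Tu Tv Tw.
  rewrite !proj1_metricE // ?bloch_metric_linearl //.
  exact: proj1_tangent_linear.
- move=> p v w Xp; rewrite tangent_proj1 // => Tv Tw.
  by rewrite !proj1_metricE // bloch_metricC.
- move=> p v Xp; rewrite tangent_proj1 // => Tv; rewrite proj1_metricE //.
  exact: bloch_metric_gt0.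
move=> z [Xz _ _].
pose V := (realM2 R * realM2 R * realM2 R)%type : normedModType R.
have oT : open (setT : set V) := openT.
pose N (y : V) : R^o := dotr (re3 y.1.1) (re3 y.1.1).
have oU : open [set y | 0 < N y].
  have C1 := Cn_on_re3 oT (Cn_on_fst oT (Cn_on_fst oT (Cn_on_id oT 0))).
  exact: (@open_pos _ N (Cn_on_dotr oT C1 C1)).
exists [set y | 0 < N y], (fun y => bloch_metric y.1.1 y.1.2 y.2); split => //.
- exact: re3_proj1_gt0.
- move=> n; have Cid : Cn_on n [set y | 0 < N y] (id : V -> V) by exact: Cn_on_id.
  have C1 := Cn_on_fst oU Cid; have C3 := Cn_on_snd oU Cid.
  have C2 := Cn_on_snd oU C1; have {}C1 := Cn_on_fst oU C1.
  have CN : Cn_on n [set y | 0 < N y] (fun y => Num.sqrt (N y) : R^o).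
    apply: Cn_on_sqrt => //; apply: Cn_on_dotr => //; exact: Cn_on_re3.
  have CV : Cn_on n [set y | 0 < N y] (fun y => (Num.sqrt (N y))^-1 : R^o).
    by apply: Cn_on_inv => // y Uy; rewrite gt_eqF // sqrtr_gt0.
  have Cr1 := Cn_on_re3 oU C1; have Ci1 := Cn_on_im3 oU C1.
  have Cr2 := Cn_on_re3 oU C2; have Ci2 := Cn_on_im3 oU C2.
  have Cr3 := Cn_on_re3 oU C3; have Ci3 := Cn_on_im3 oU C3.
  apply: Cn_on_sub => //.
    by apply: Cn_on_mul => //; apply: Cn_on_add => //; apply: Cn_on_dotr.
  apply: Cn_on_mul => //.
    by apply: Cn_on_add => //; apply: Cn_on_mul => //; apply: Cn_on_dotr.
  apply: (Cn_on_ext oU) (Cn_on_mul oU CV (Cn_on_mul oU CV CV)) => y _.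
  by rewrite -exprVn !exprS expr0 mulr1.
- move=> y [Xy T1 T2] _; rewrite /= proj1_metricE //; by rewrite -tangent_proj1.
Qed.

End Proj1.

(** * The Eguchi-Hanson tensor on the tangent bundle of the sphere *)

Section EHTensor.
Variables (R : realType) (a : R).
Hypothesis a0 : 0 < a.
Local Notation EH_type := ('rV[R]_3 * 'rV[R]_3)%type.

Definition EH_radius (z : EH_type) : R := Num.sqrt (1 + dotr z.2 z.2 / a ^+ 4).

(* EH_radius is r^2/a^2 in the chart; the second summand is the squared norm
   of the part of v.2 tangent to the sphere. *)
Definition EH_tensor (z v w : EH_type) : R :=
  a ^+ 2 / 4 * (EH_radius z * dotr v.1 w.1
    + (dotr v.2 w.2 - dotr z.1 v.2 * dotr z.1 w.2) / (a ^+ 4 * EH_radius z)).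

Lemma EH_radius_sqr_gt0 (z : EH_type) : 0 < 1 + dotr z.2 z.2 / a ^+ 4.
Proof. by rewrite ltr_pwDl // divr_ge0 ?dotr_ge0 // exprn_ge0 // ltW. Qed.

Lemma EH_radius_gt0 z : 0 < EH_radius z.
Proof. by rewrite sqrtr_gt0 EH_radius_sqr_gt0. Qed.

Lemma sqr_EH_radius z : EH_radius z ^+ 2 = 1 + dotr z.2 z.2 / a ^+ 4.
Proof. by rewrite sqr_sqrtr // ltW // EH_radius_sqr_gt0. Qed.

Lemma EH_tangentP z v : EH_space R z -> tangent (EH_space R) z v ->
  dotr z.1 v.1 = 0 /\ dotr z.1 v.2 + dotr z.2 v.1 = 0.
Proof.
move=> Ez [c Cc ->]; have dc := smooth_curve_is_derive Cc.
case: Cc => c0 [J [oJ J0 _ cJ]].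
have d1 := is_derive_fst dc; have d2 := is_derive_snd dc.
have h1 := is_derive_near_cst (w := 1 : R^o) oJ J0 _ (is_derive_dotr d1 d1).
have h2 := is_derive_near_cst (w := 0 : R^o) oJ J0 _ (is_derive_dotr d1 d2).
rewrite c0 in h1 h2; split; last by apply: h2 => s /cJ[].
have {}h1 := h1 (fun s Js => (cJ s Js).1).
by move: h1; set x := dotr _ _ => h1; lra.
Qed.

Lemma EH_tensor_gt0 z v : EH_space R z -> tangent (EH_space R) z v -> v != 0 ->
  0 < EH_tensor z v v.
Proof.
move=> Ez /(EH_tangentP Ez)[_ zv] v0; case: Ez => zz _.
have r0 := EH_radius_gt0 z.
have cs := dotr_CauchySchwarz z.1 v.2; rewrite zz mul1r in cs.
rewrite mulr_gt0 ?divr_gt0 ?exprn_gt0 //.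
have k0 : 0 <= (dotr v.2 v.2 - dotr z.1 v.2 * dotr z.1 v.2) / (a ^+ 4 * EH_radius z).
  by rewrite divr_ge0 ?subr_ge0 // mulr_ge0 ?exprn_ge0 // ltW.
have [v10|v10] := eqVneq v.1 0; last first.
  rewrite ltr_pwDl // mulr_gt0 // lt_neqAle dotr_ge0 andbT eq_sym.
  by apply: contra v10 => /eqP/dotr_eq0 ->.
have dz0 : dotr z.1 v.2 = 0.
  by move: zv; rewrite v10 -[0 : 'rV[R]_3](scale0r (0 : 'rV[R]_3)) dotrZr mul0r addr0.
rewrite v10 -[0 : 'rV[R]_3](scale0r (0 : 'rV[R]_3)) dotrZr mul0r mulr0 add0r.
rewrite dz0 mul0r subr0 divr_gt0 ?mulr_gt0 ?exprn_gt0 //.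
rewrite lt_neqAle dotr_ge0 andbT eq_sym; apply: contra v0 => /eqP/dotr_eq0 v20.
by case: v v10 v20 {zv cs k0 dz0} => v1 v2 /= -> ->.
Qed.

Lemma Cn_on_EH_radius (V : normedModType R) (U : set V) n (f : V -> EH_type) :
  open U -> Cn_on n U f -> Cn_on n U (fun x => EH_radius (f x) : R^o).
Proof.
move=> oU Cf; have C2 := Cn_on_snd oU Cf; apply: Cn_on_sqrt => // [x _|].
  exact: EH_radius_sqr_gt0.
apply: Cn_on_add => //; first exact: Cn_on_cst.
by apply: Cn_on_mul => //; [exact: Cn_on_dotr|exact: Cn_on_cst].
Qed.

Lemma EH_tensor_riemannian : riemannian_metric (EH_space R) EH_tensor.
Proof.
split.
- move=> p u v w k _ _ _ _; rewrite /EH_tensor /= !(dotrDl, dotrZl, dotrDr, dotrZr).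
  by field; rewrite !gt_eqF // EH_radius_gt0.
- move=> p v w _ _ _; rewrite /EH_tensor [dotr v.1 _]dotrC [dotr v.2 _]dotrC.
  by rewrite [dotr p.1 v.2 * _]mulrC.
- exact: EH_tensor_gt0.
move=> z _; pose V := (EH_type * EH_type * EH_type)%type : normedModType R.
have oT : open (setT : set V) := openT.
exists setT, (fun y => EH_tensor y.1.1 y.1.2 y.2); split => // n.
have Cid : Cn_on n setT (id : V -> V) by exact: Cn_on_id.
have C1 := Cn_on_fst oT Cid; have C3 := Cn_on_snd oT Cid.
have C2 := Cn_on_snd oT C1; have {}C1 := Cn_on_fst oT C1.
have Cr := Cn_on_EH_radius oT C1.
have Cd := Cn_on_dotr oT; have Cc (k : R) := Cn_on_cst oT n (k : R^o).
have C11 := Cn_on_fst oT C1.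
have C21 := Cn_on_fst oT C2; have C22 := Cn_on_snd oT C2.
have C31 := Cn_on_fst oT C3; have C32 := Cn_on_snd oT C3.
have Cden := Cn_on_mul oT (Cc (a ^+ 4)) Cr.
have CV := Cn_on_inv oT (fun x _ => mulf_neq0 _ (lt0r_neq0 (EH_radius_gt0 _))) Cden.
have {}CV := CV (lt0r_neq0 (exprn_gt0 4 a0)).
exact: (Cn_on_mul oT (Cc (a ^+ 2 / 4)) (Cn_on_add oT
  (Cn_on_mul oT Cr (Cd _ _ _ C21 C31))
  (Cn_on_mul oT (Cn_on_sub oT (Cd _ _ _ C22 C32)
    (Cn_on_mul oT (Cd _ _ _ C11 C22) (Cd _ _ _ C11 C32))) CV))).
Qed.

Definition mx2 (x y z t : R) : 'M[R]_2 :=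
  \matrix_(i, j) (if i == 0 then if j == 0 then x else y
                  else if j == 0 then z else t).

(* The inverse of q |-> (re3 q, im3 q) on matrices of trace one. *)
Definition bloch (x y : 'rV[R]_3) : realM2 R :=
  let x1 := x 0 (inord 0) in let x2 := x 0 (inord 1) in let x3 := x 0 (inord 2) in
  let y1 := y 0 (inord 0) in let y2 := y 0 (inord 1) in let y3 := y 0 (inord 2) in
  (mx2 ((1 + x3) / 2) ((x1 + y2) / 2) ((x1 - y2) / 2) ((1 - x3) / 2),
   mx2 (y3 / 2) ((y1 - x2) / 2) ((y1 + x2) / 2) (- y3 / 2)).

Lemma re3_bloch x y : re3 (bloch x y) = x.
Proof.
have [[x1 [x2 [x3 ->]]] [y1 [y2 [y3 ->]]]] := (vec3P x, vec3P y).
by rewrite /re3 /= !mxE /= !inordK //=; congr vec3; field.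
Qed.

Lemma im3_bloch x y : im3 (bloch x y) = y.
Proof.
have [[x1 [x2 [x3 ->]]] [y1 [y2 [y3 ->]]]] := (vec3P x, vec3P y).
by rewrite /im3 /= !mxE /= !inordK //=; congr vec3; field.
Qed.

Lemma tr_bloch x y : \tr (bloch x y).1 = 1 /\ \tr (bloch x y).2 = 0.
Proof. by rewrite !trace2 !mxE /=; split; field. Qed.

Lemma bloch_re3_im3 (q : realM2 R) : \tr q.1 = 1 -> \tr q.2 = 0 ->
  bloch (re3 q) (im3 q) = q.
Proof.
rewrite !trace2 /bloch !mxE !inordK //=; case: q => P Q /= hP hQ.
have p1 : P 1 1 = 1 - P 0 0 by rewrite -hP; ring.
have q1 : Q 1 1 = - Q 0 0 by apply/eqP; rewrite -addr_eq0 addrC hQ.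
by congr pair; apply: mx2P; rewrite !mxE /= ?p1 ?q1; field.
Qed.

Definition proj1_to_EH (q : realM2 R) : EH_type :=
  ((Num.sqrt (dotr (re3 q) (re3 q)))^-1 *: re3 q, a ^+ 2 *: im3 q).

Definition EH_to_proj1 (z : EH_type) : realM2 R :=
  bloch (EH_radius z *: z.1) (a ^- 2 *: z.2).

Lemma EH_radius_proj1 q : proj1_space R q ->
  EH_radius (proj1_to_EH q) = Num.sqrt (dotr (re3 q) (re3 q)).
Proof.
move=> /proj1_spaceE[_ _ xy _]; rewrite /EH_radius /= dotrZl dotrZr xy.
by congr (Num.sqrt (_ + _)); field; rewrite gt_eqF.
Qed.

Lemma proj1_EH_diffeomorphism :
  diffeomorphism (proj1_space R) (EH_space R) proj1_to_EH.
Proof.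
have Vpos (q : realM2 R) : proj1_space R q -> let x := dotr (re3 q) (re3 q) in
    0 < Num.sqrt x /\ Num.sqrt x ^+ 2 = x.
  move=> Xq; have := re3_proj1_gt0 Xq => /= x0.
  by rewrite sqrtr_gt0 sqr_sqrtr // ltW.
split.
- move=> q Xq; have oT : open (setT : set (realM2 R)) := openT.
  pose N (y : realM2 R) : R^o := dotr (re3 y) (re3 y).
  have oU : open [set y | 0 < N y].
    have C1 := Cn_on_re3 oT (Cn_on_id oT 0).
    exact: (@open_pos _ _ N (Cn_on_dotr oT C1 C1)).
  exists [set y | 0 < N y], proj1_to_EH; split => //; first exact: re3_proj1_gt0.
  move=> n; have Cid : Cn_on n [set y | 0 < N y] (id : realM2 R -> _) by exact: Cn_on_id.
  have Cr := Cn_on_re3 oU Cid; have Ci := Cn_on_im3 oU Cid.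
  apply: Cn_on_pair => //; apply: Cn_on_scale3 => //; last exact: Cn_on_cst.
  apply: Cn_on_inv => // [y Uy|]; first by rewrite gt_eqF // sqrtr_gt0.
  by apply: Cn_on_sqrt => //; exact: Cn_on_dotr.
- move=> q Xq; have [n0 nn] := Vpos _ Xq; case/proj1_spaceE : Xq => _ _ _ xy.
  rewrite /EH_space /= !(dotrZl, dotrZr) xy !mulr0; split=> //.
  by move: nn n0; set s := Num.sqrt _ => <- s0; field; rewrite gt_eqF.
exists EH_to_proj1; split.
- move=> z _; have oT : open (setT : set (EH_type : normedModType R)) := openT.
  exists setT, EH_to_proj1; split => // n.
  have Cid : Cn_on n setT (id : (EH_type : normedModType R) -> EH_type) by exact: Cn_on_id.
  have Cx : Cn_on n setT (fun z : EH_type => EH_radius z *: z.1).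
    by apply: Cn_on_scale3 => //; [exact: Cn_on_EH_radius|exact: Cn_on_fst].
  have Cy : Cn_on n setT (fun z : EH_type => a ^- 2 *: z.2).
    by apply: Cn_on_scale3 => //; [exact: Cn_on_cst|exact: Cn_on_snd].
  have Cc (k : R) := Cn_on_cst oT n (k : R^o).
  have Cxk k := Cn_on_coord oT 0 k Cx; have Cyk k := Cn_on_coord oT 0 k Cy.
  have Cmx (f1 f2 f3 f4 : EH_type -> R^o) : Cn_on n setT f1 -> Cn_on n setT f2 ->
      Cn_on n setT f3 -> Cn_on n setT f4 ->
      Cn_on n setT (fun p => mx2 (f1 p) (f2 p) (f3 p) (f4 p)).
    move=> C1 C2 C3 C4; apply: Cn_on_mx => // i j.
    have [i0|i0] := eqVneq i 0; have [j0|j0] := eqVneq j 0;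
    [move: C1|move: C2|move: C3|move: C4]; apply: Cn_on_ext => // p _;
    by rewrite mxE ?i0 ?j0 ?(negPf i0) ?(negPf j0).
  apply: Cn_on_pair => //; apply: Cmx; apply: Cn_on_mul => //;
    try (by apply: Cn_on_add); try (by apply: Cn_on_sub); by apply: Cn_on_opp.
- move=> z Ez; have r2 := sqr_EH_radius z; case: Ez => zz zw.
  apply/proj1_spaceE; rewrite /EH_to_proj1 re3_bloch im3_bloch.
  have [-> ->] := tr_bloch (EH_radius z *: z.1) (a ^- 2 *: z.2).
  split=> //; rewrite !(dotrZl, dotrZr) ?zw ?mulr0 // zz mulr1 -expr2 r2.
  by congr (_ + _); field; rewrite gt_eqF.
- move=> q Xq; rewrite /EH_to_proj1 (EH_radius_proj1 Xq) /= !scalerA.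
  have [n0 nn] := Vpos _ Xq; case/proj1_spaceE : Xq => t1 t2 _ _.
  rewrite divff ?gt_eqF // mulVf ?expf_neq0 ?gt_eqF // !scale1r.
  exact: bloch_re3_im3.
- move=> [z w] [/= zz zw]; have r0 := EH_radius_gt0 (z, w).
  rewrite /proj1_to_EH /EH_to_proj1 /= re3_bloch im3_bloch !(dotrZl, dotrZr) zz mulr1.
  rewrite -expr2 sqrtr_sqr ger0_norm ?ltW // !scalerA mulVf ?gt_eqF //.
  by rewrite divff ?expf_neq0 ?gt_eqF // !scale1r.
Qed.

Lemma proj1_EH_pullback :
  pullback_is (proj1_space R) proj1_to_EH EH_tensor
    (fun q A B => a ^+ 2 / 4 * proj1_metric q A B).
Proof.
move=> q c d Cc Cd.
have Xq : proj1_space R q.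
  by case: Cc => <- [J [_ J0 _ cJ]]; exact: cJ.
have n0 := re3_proj1_gt0 Xq.
have dF (e : R -> realM2 R) : smooth_curve (proj1_space R) q e ->
  let n := Num.sqrt (dotr (re3 q) (re3 q)) in let A := derive1 e 0 in
  derive1 (proj1_to_EH \o e) 0 =
  (n^-1 *: re3 A +
     (- n ^- 2 * ((dotr (re3 q) (re3 A) + dotr (re3 q) (re3 A)) / (2 * n)))
       *: re3 q,
   a ^+ 2 *: im3 A).
  move=> Ce n A; have de := smooth_curve_is_derive Ce; have e0 := Ce.1.
  have dr := is_derive_re3 de; have di := is_derive_im3 de.
  have dn := is_derive_sqrt _ (is_derive_dotr dr dr).
  rewrite e0 in dn; have {}dn := dn n0.
  have dV := is_derive_inv _ dn; rewrite e0 in dV.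
  have {}dV := dV (lt0r_neq0 _).
  have dp := is_derive_pair (is_derive_scale3 (dV _) dr)
    (is_derive_scale3 (is_derive_cst (a ^+ 2 : R^o) (0 : R) (1 : R)) di).
  have {}dp := dp _; rewrite e0 scale0r addr0 in dp.
  by apply: is_derive1E; apply: dp; rewrite sqrtr_gt0.
have tA (e : R -> realM2 R) :
    smooth_curve (proj1_space R) q e -> proj1_tangent q (derive1 e 0).
  by move=> Ce; rewrite -tangent_proj1 //; exists e.
rewrite (dF _ Cc) (dF _ Cd).
have TA := tA _ Cc; have TB := tA _ Cd.
rewrite proj1_metricE //.
move: (derive1 c 0) (derive1 d 0) TA TB => A B.
move=> /(proj1_tangentE _ Xq)[_ _ _ fA] /(proj1_tangentE _ Xq)[_ _ _ fB].
rewrite /EH_tensor EH_radius_proj1 // /bloch_metric /=.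
set n := Num.sqrt _; have np : 0 < n by rewrite sqrtr_gt0.
have nn : dotr (re3 q) (re3 q) = n ^+ 2 by rewrite sqr_sqrtr ?ltW.
rewrite !(dotrZl, dotrZr, dotrDl, dotrDr) nn.
have {}fA : dotr (re3 q) (im3 A) = - dotr (im3 q) (re3 A).
  by apply/eqP; rewrite -addr_eq0 fA.
have {}fB : dotr (re3 q) (im3 B) = - dotr (im3 q) (re3 B).
  by apply/eqP; rewrite -addr_eq0 fB.
rewrite fA fB [dotr (re3 A) (re3 q)]dotrC [dotr (re3 B) (re3 q)]dotrC.
rewrite [dotr (re3 A) (im3 q)]dotrC [dotr (re3 B) (im3 q)]dotrC.
by field; rewrite !gt_eqF.
Qed.

End EHTensor.

(** * The chart over SU(2) *)

Lemma det_mx22 (K : comPzRingType) (A : 'M[K]_2) :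
  \det A = A 0 0 * A 1 1 - A 0 1 * A 1 0.
Proof.
rewrite (expand_det_row _ 0) big_ord_recr big_ord1 /= /cofactor !det_mx11 !mxE /=.
rewrite expr0 expr1 mul1r mulN1r mulrN.
by congr (A _ _ * A _ _ - A _ _ * A _ _); apply/val_inj.
Qed.

Section Chart.
Local Open Scope sesquilinear_scope.
Variable R : realType.
Implicit Types u xi : realM2 R.

(* The matrix with first column (p + iq, r + is) and its SU(2) completion. *)
Definition su2 (p q r s : R) : realM2 R := (mx2 p (- r) r p, mx2 q s s (- q)).

Lemma SU2_su2 u : SU2 R u ->
  u = su2 (u.1 0 0) (u.2 0 0) (u.1 1 0) (u.2 1 0) /\
  u.1 0 0 * u.1 0 0 + u.2 0 0 * u.2 0 0 + u.1 1 0 * u.1 1 0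
    + u.2 1 0 * u.2 1 0 = 1.
Proof.
move=> [/unitarymxP/mulmx1C uu]; set M := cmat u in uu *.
have -> : \det M = M 0 0 * M 1 1 - M 0 1 * M 1 0 by rewrite det_mx22.
have h i j := congr1 (fun A : 'M[R[i]]_2 => A i j) uu.
have h00 := h 0 0; have h01 := h 0 1; rewrite /= !mulmx2 !mxE /= in h00 h01.
have Mc i j : M i j = (u.1 i j +i* u.2 i j)%C by rewrite cmatE.
rewrite /GRing.natmul /= in h00 h01.
move: h00 h01; rewrite -!Mc.
move=> h00 h01 hd.
have e1 : M 1 1 = (M 0 0)^*.
  have -> : (M 0 0)^* = M 1 1 * ((M 0 0)^* * M 0 0 + (M 1 0)^* * M 1 0)
      - M 1 0 * ((M 0 0)^* * M 0 1 + (M 1 0)^* * M 1 1)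
      + (M 0 0)^* * (1 - (M 0 0 * M 1 1 - M 0 1 * M 1 0)) by ring.
  by rewrite h00 h01 hd; ring.
have e2 : (M 1 0)^* = - M 0 1.
  have -> : (M 1 0)^* = M 0 0 * ((M 0 0)^* * M 0 1 + (M 1 0)^* * M 1 1)
      - M 0 1 * ((M 0 0)^* * M 0 0 + (M 1 0)^* * M 1 0)
      + (M 1 0)^* * (1 - (M 0 0 * M 1 1 - M 0 1 * M 1 0)) by ring.
  by rewrite h00 h01 hd; ring.
move: e1 e2 h00; rewrite !Mc; case: u {M uu h h01 hd Mc} => P Q /=.
simpc => /=; rewrite /= => -[e1 e1'] [e2 e2'] [e3].
have {}e2 : P 0 1 = - P 1 0 by rewrite e2 opprK.
have {}e2' : Q 0 1 = Q 1 0 by apply: oppr_inj.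
split; last by rewrite -e3; ring.
by congr pair; apply: mx2P; rewrite !mxE.
Qed.

Lemma cmul_mx2 (x y z t x' y' z' t' b c d e b' c' d' e' : R) :
  cmul (mx2 x y z t, mx2 x' y' z' t') (mx2 b c d e, mx2 b' c' d' e') =
  (mx2 (x * b + y * d - (x' * b' + y' * d')) (x * c + y * e - (x' * c' + y' * e'))
       (z * b + t * d - (z' * b' + t' * d')) (z * c + t * e - (z' * c' + t' * e')),
   mx2 (x * b' + y * d' + (x' * b + y' * d)) (x * c' + y * e' + (x' * c + y' * e))
       (z * b' + t * d' + (z' * b + t' * d)) (z * c' + t * e' + (z' * c + t' * e))).
Proof. by congr pair; apply: mx2P; rewrite !mx2E !mxE. Qed.

Lemma cadj_mx2 (x y z t x' y' z' t' : R) :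
  cadj (mx2 x y z t, mx2 x' y' z' t') =
  (mx2 x z y t, mx2 (- x') (- z') (- y') (- t')).
Proof. by congr pair; apply: mx2P; rewrite !mxE. Qed.

Lemma trace_mx2 (x y z t : R) : \tr (mx2 x y z t) = x + t.
Proof. by rewrite trace2 !mxE. Qed.

Definition pauli_real (k : nat) : realM2 R :=
  nth (0, 0) [:: (mx2 0 1 1 0, mx2 0 0 0 0); (mx2 0 0 0 0, mx2 0 (- 1) 1 0);
                 (mx2 1 0 0 (- 1), mx2 0 0 0 0)] k.

Lemma pauliE (k : 'I_3) : pauli R k = cmat (pauli_real k).
Proof.
case: k => [[|[|[|//]]] ?]; rewrite /pauli (tnth_nth 0) /=;
  by apply: mx2P; rewrite !mxE /=; simpc.
Qed.

(* Columns of the rotation Ad(su2 p q r s). *)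
Definition rot1 (p q r s : R) : 'rV[R]_3 :=
  vec3 (p * p - q * q - r * r + s * s) (- (2 * (p * q + r * s)))
    (- (2 * (p * r - q * s))).
Definition rot2 (p q r s : R) : 'rV[R]_3 :=
  vec3 (2 * (p * q - r * s)) (p * p - q * q + r * r - s * s)
    (- (2 * (p * s + q * r))).
Definition rot3 (p q r s : R) : 'rV[R]_3 :=
  vec3 (2 * (p * r + q * s)) (2 * (p * s - q * r))
    (p * p + q * q - r * r - s * s).

Lemma Ad_col_su2 p q r s :
  Ad_col (su2 p q r s) (inord 2) = rot3 p q r s /\
  Ad_col (su2 p q r s) (inord 0) = rot1 p q r s.
Proof.
by split; apply/rowP => -[[|[|[|//]]] ?];
  rewrite !mxE /= !pauliE inordK // /pauli_real /su2 /=
    cmat_adj !cmat_mul cadj_mx2 !cmul_mx2 tr_cmat /= trace_mx2;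
  field.
Qed.

Lemma sigma_su2 p q r s p' q' r' s' :
  [/\ sigma (inord 0) (su2 p q r s) (su2 p' q' r' s') =
        - (2 * (p * s' + q * r' - r * q' - s * p')),
      sigma (inord 1) (su2 p q r s) (su2 p' q' r' s') =
        2 * (p * r' - q * s' - r * p' + s * q') &
      sigma (inord 2) (su2 p q r s) (su2 p' q' r' s') =
        - (2 * (p * q' - q * p' + r * s' - s * r'))].
Proof.
by split; rewrite /sigma pauliE inordK // /pauli_real /su2 /=
    cmat_adj !cmat_mul cadj_mx2 !cmul_mx2 tr_cmat /= trace_mx2; ring.
Qed.

Lemma eq_of_constraints (l r e n d : R) :
  n = 1 -> d = 0 -> l * n = r + e * d -> l = r.
Proof. by move=> -> ->; rewrite mulr1 mulr0 addr0. Qed.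

Lemma rot_orthonormal p q r s : p * p + q * q + r * r + s * s = 1 ->
  [/\ dotr (rot1 p q r s) (rot1 p q r s) = 1,
      dotr (rot2 p q r s) (rot2 p q r s) = 1 &
      dotr (rot3 p q r s) (rot3 p q r s) = 1] /\
  [/\ dotr (rot1 p q r s) (rot2 p q r s) = 0,
      dotr (rot1 p q r s) (rot3 p q r s) = 0 &
      dotr (rot2 p q r s) (rot3 p q r s) = 0].
Proof.
move=> N1; have NN : (p * p + q * q + r * r + s * s) ^+ 2 = 1 by rewrite N1 expr1n.
by rewrite !dotr_vec3; split; split; try ring; rewrite -[RHS]NN; ring.
Qed.

Lemma is_derive_opp (t : R) (f : R -> R^o) (d : R) :
  is_derive t 1 f d -> is_derive t 1 (fun x => - f x : R^o) (- d).
Proof. exact: is_deriveN. Qed.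

Ltac derive_polynomial := repeat first
  [ eassumption | refine (is_derive_add _ _) | refine (is_derive_sub _ _)
  | refine (is_derive_opp _) | refine (is_derive_mul _ _)
  | refine (is_derive_cst _ _ _)].

(* The frame rot1, rot2, rot3 rotates with angular velocity given by the
   left-invariant coframe: d rot_j = sum_k sigma_k (rot_k x rot_j). *)
Lemma is_derive_rot (t : R) (p q r s : R -> R^o) (p' q' r' s' : R) :
  is_derive t 1 p p' -> is_derive t 1 q q' -> is_derive t 1 r r' ->
  is_derive t 1 s s' ->
  p t * p t + q t * q t + r t * r t + s t * s t = 1 ->
  p t * p' + q t * q' + r t * r' + s t * s' = 0 ->
  let sg k := sigma (inord k) (su2 (p t) (q t) (r t) (s t)) (su2 p' q' r' s') in
  let E1 := rot1 (p t) (q t) (r t) (s t) in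
  let E2 := rot2 (p t) (q t) (r t) (s t) in
  let E3 := rot3 (p t) (q t) (r t) (s t) in
  is_derive t 1 (fun x => rot1 (p x) (q x) (r x) (s x))
    (sg 2%N *: E2 + (- sg 1%N) *: E3) /\
  is_derive t 1 (fun x => rot3 (p x) (q x) (r x) (s x))
    (sg 1%N *: E1 + (- sg 0%N) *: E2).
Proof.
move=> dp dq dr ds N1 D0 sg E1 E2 E3; rewrite /sg.
have [-> -> ->] := sigma_su2 (p t) (q t) (r t) (s t) p' q' r' s'.
rewrite /E1 /E2 /E3 /rot1 /rot2 /rot3 !vec3Z !vec3D; split.
  eapply is_derive_eq; first (apply: is_derive_vec3; derive_polynomial).
  congr vec3.
  - apply: (eq_of_constraints
      (e := 2 * (p t * p t - q t * q t - r t * r t + s t * s t)) N1 D0).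
    by rewrite /GRing.scale /=; ring.
  - apply: (eq_of_constraints (e := 2 * - (2 * (p t * q t + r t * s t))) N1 D0).
    by rewrite /GRing.scale /=; ring.
  - apply: (eq_of_constraints (e := 2 * - (2 * (p t * r t - q t * s t))) N1 D0).
    by rewrite /GRing.scale /=; ring.
  eapply is_derive_eq; first (apply: is_derive_vec3; derive_polynomial).
  congr vec3.
  - apply: (eq_of_constraints (e := 2 * (2 * (p t * r t + q t * s t))) N1 D0).
    by rewrite /GRing.scale /=; ring.
  - apply: (eq_of_constraints (e := 2 * (2 * (p t * s t - q t * r t))) N1 D0).
    by rewrite /GRing.scale /=; ring.
  - apply: (eq_of_constraints
      (e := 2 * (p t * p t + q t * q t - r t * r t - s t * s t)) N1 D0).
    by rewrite /GRing.scale /=; ring.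
Qed.

Lemma EH_formula_rot (a r dr dr' s1 s2 s3 s1' s2' s3' : R)
    (E1 E2 E3 : 'rV[R]_3) : 0 < a -> a < r ->
  [/\ dotr E1 E1 = 1, dotr E2 E2 = 1 & dotr E3 E3 = 1] ->
  [/\ dotr E1 E2 = 0, dotr E1 E3 = 0 & dotr E2 E3 = 0] ->
  let S := Num.sqrt (r ^+ 4 - a ^+ 4) in
  let v dr s1 s2 s3 := (s2 *: E1 + (- s1) *: E2,
    S *: (s3 *: E2 + (- s2) *: E3) + (4 * r ^+ 3 * dr / (2 * S)) *: E1) in
  EH_tensor a (E3, S *: E1) (v dr s1 s2 s3) (v dr' s1' s2' s3') =
  (dr * dr') / (1 - a ^+ 4 / r ^+ 4) + r ^+ 2 / 4 * (s1 * s1' + s2 * s2')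
  + r ^+ 2 / 4 * (1 - a ^+ 4 / r ^+ 4) * (s3 * s3').
Proof.
move=> a0 ar [e11 e22 e33] [e12 e13 e23] S v.
have e21 : dotr E2 E1 = 0 by rewrite dotrC.
have e31 : dotr E3 E1 = 0 by rewrite dotrC.
have e32 : dotr E3 E2 = 0 by rewrite dotrC.
have r0 : 0 < r by exact: lt_trans ar.
have ra4 : 0 < r ^+ 4 - a ^+ 4 by rewrite subr_gt0 ltrXn2r // ltW.
have S0 : 0 < S by rewrite sqrtr_gt0.
have SS : S ^+ 2 = r ^+ 4 - a ^+ 4 by rewrite sqr_sqrtr ?ltW.
have rho : EH_radius a (E3, S *: E1) = r ^+ 2 / a ^+ 2.
  rewrite /EH_radius /= dotrZl dotrZr e11 mulr1 -expr2 SS.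
  have -> : 1 + (r ^+ 4 - a ^+ 4) / a ^+ 4 = (r ^+ 2 / a ^+ 2) ^+ 2.
    by field; rewrite gt_eqF.
  by rewrite sqrtr_sqr ger0_norm // divr_ge0 // exprn_ge0 // ltW.
rewrite /EH_tensor rho /= !(dotrDl, dotrDr, dotrZl, dotrZr).
rewrite e11 e22 e33 e12 e13 e23 e21 e31 e32 !(mulr0, addr0, add0r, mulr1).
have -> : 1 - a ^+ 4 / r ^+ 4 = S ^+ 2 / r ^+ 4 by rewrite SS; field; rewrite gt_eqF.
by field; rewrite !gt_eqF.
Qed.

End Chart.

Section ChartPullback.
Variable R : realType.

Lemma is_derive_su2 (t : R) (p q r s : R -> R^o) (p' q' r' s' : R) :
  is_derive t 1 p p' -> is_derive t 1 q q' -> is_derive t 1 r r' ->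
  is_derive t 1 s s' ->
  is_derive t 1 (fun x => su2 (p x) (q x) (r x) (s x)) (su2 p' q' r' s').
Proof.
move=> dp dq dr ds; have dr' := is_derive_opp dr; have dq' := is_derive_opp dq.
apply: is_derive_pair; apply: is_derive_mx => i j;
  have [i0|i0] := eqVneq i 0; have [j0|j0] := eqVneq j 0;
  rewrite mxE ?i0 ?j0 ?(negPf i0) ?(negPf j0) /=;
  by under eq_fun do rewrite mxE /= ?(negPf i0) ?(negPf j0).
Qed.

Lemma SU2_velocity (c : R -> realM2 R) d (J : set R) (t : R) :
  open J -> J t -> (forall x, J x -> SU2 R (c x)) -> is_derive t 1 c d ->
  d = su2 (d.1 0 0) (d.2 0 0) (d.1 1 0) (d.2 1 0) /\
  (c t).1 0 0 * d.1 0 0 + (c t).2 0 0 * d.2 0 0 + (c t).1 1 0 * d.1 1 0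
    + (c t).2 1 0 * d.2 1 0 = 0.
Proof.
move=> oJ Jt cJ dc; have d1 := is_derive_fst dc; have d2 := is_derive_snd dc.
have dp := is_derive_coord 0 0 d1; have dq := is_derive_coord 0 0 d2.
have dr := is_derive_coord 1 0 d1; have ds := is_derive_coord 1 0 d2.
split.
  apply/eqP; rewrite -subr_eq0; apply/eqP.
  apply: (is_derive_near_cst (w := 0 : realM2 R) oJ Jt _
    (is_derive_sub dc (is_derive_su2 dp dq dr ds))) => x /cJ /SU2_su2[cE _].
  by apply/eqP; rewrite subr_eq0; apply/eqP.
have h := is_derive_near_cst (w := 1 : R^o) oJ Jt _ (is_derive_add (is_derive_add
  (is_derive_add (is_derive_mul dp dp) (is_derive_mul dq dq)) (is_derive_mul dr dr))
  (is_derive_mul ds ds)).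
by move: (h (fun x Jx => (SU2_su2 (cJ x Jx)).2)); lra.
Qed.

Lemma EH_chart_pullback (a : R) : 0 < a ->
  pullback_is (EH_domain a) (EH_chart a) (EH_tensor a) (EH_formula a).
Proof.
move=> a0 p c d Cc Cd.
have [ar Up] : EH_domain a p by case: Cc => <- [J [_ J0 _ cJ]]; exact: cJ.
have [p2E N1] := SU2_su2 Up.
set P := p.2.1 0 0 in p2E N1; set Q := p.2.2 0 0 in p2E N1.
set V := p.2.1 1 0 in p2E N1; set W := p.2.2 1 0 in p2E N1.
have pE : EH_chart a p =
    (rot3 P Q V W, Num.sqrt ((p.1 : R) ^+ 4 - a ^+ 4) *: rot1 P Q V W).
  by rewrite /EH_chart p2E; have [-> ->] := Ad_col_su2 P Q V W.
have dchart (e : R -> R^o * realM2 R) : smooth_curve (EH_domain a) p e ->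
    let v := derive1 e 0 in let sg k := sigma (inord k) p.2 v.2 in
    let S := Num.sqrt ((p.1 : R) ^+ 4 - a ^+ 4) in
    derive1 (EH_chart a \o e) 0 =
    (sg 1%N *: rot1 P Q V W + (- sg 0%N) *: rot2 P Q V W,
     S *: (sg 2%N *: rot2 P Q V W + (- sg 1%N) *: rot3 P Q V W)
     + (4 * (p.1 : R) ^+ 3 * v.1 / (2 * S)) *: rot1 P Q V W).
  move=> Ce v sg S; have de := smooth_curve_is_derive Ce; rewrite -/v in de.
  case: Ce => e0 [J [oJ J0 _ eJ]].
  have d1 := is_derive_fst de; have d2 := is_derive_snd de.
  have eJ2 x : J x -> SU2 R (e x).2 by case/eJ.
  have [v2E D0] := SU2_velocity oJ J0 eJ2 d2.
  have d21 := is_derive_fst d2; have d22 := is_derive_snd d2.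
  have dp := is_derive_coord 0 0 d21; have dq := is_derive_coord 0 0 d22.
  have dr := is_derive_coord 1 0 d21; have ds := is_derive_coord 1 0 d22.
  have := is_derive_rot dp dq dr ds; rewrite e0 in D0 *.
  rewrite -/P -/Q -/V -/W -p2E -v2E.
  move=> /(_ N1 D0) [dE1 dE3].
  have dS4 : is_derive (0 : R) 1 (fun x => (e x).1 ^+ 4 - a ^+ 4 : R^o)
      (4 * (p.1 : R) ^+ 3 * v.1).
    have -> : (fun x => (e x).1 ^+ 4 - a ^+ 4 : R^o) =
        (fun x => (e x).1 * (e x).1 * ((e x).1 * (e x).1) - a ^+ 4 : R^o).
      by apply/funext => x; ring.
    have d11 := is_derive_mul d1 d1.
    apply: is_derive_eq (is_derive_sub (is_derive_mul d11 d11)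
      (is_derive_cst (a ^+ 4 : R^o) (0 : R) (1 : R))) _.
    by rewrite e0 /=; ring.
  have S4 : 0 < (e 0).1 ^+ 4 - a ^+ 4.
    have p0 : 0 < (p.1 : R) := lt_trans a0 ar.
    by rewrite e0 subr_gt0 ltrXn2r // ltW.
  have dS := is_derive_sqrt (f := fun x => (e x).1 ^+ 4 - a ^+ 4) S4 dS4.
  have dF := is_derive_pair dE3 (is_derive_scale3 dS dE1).
  rewrite e0 -/P -/Q -/V -/W in dF.
  apply: is_derive1E; apply: near_eq_is_derive dF.
  apply: filterS (open_nbhs_nbhs (conj oJ J0)) => x Jx.
  rewrite /= /EH_chart [in RHS](SU2_su2 (eJ2 x Jx)).1.
  by have [-> ->] := Ad_col_su2 ((e x).2.1 0 0) ((e x).2.2 0 0)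
    ((e x).2.1 1 0) ((e x).2.2 1 0).
rewrite (dchart _ Cc) (dchart _ Cd) pE.
have [rot_unit rot_orth] := rot_orthonormal N1.
by rewrite (EH_formula_rot _ _ _ _ _ _ _ _ a0 ar rot_unit rot_orth).
Qed.

End ChartPullback.

Theorem lemma6p0p20 (R : realType) (a : R) (ha : 0 < a) :
  (forall q, proj1_space R q -> tangent (proj1_space R) q = proj1_tangent q) /\
  riemannian_metric (proj1_space R) (@proj1_metric R) /\
  exists h, Eguchi_Hanson_metric a h /\
    exists2 c : R, 0 < c &
      isometric (proj1_space R) (fun q A B => c * proj1_metric q A B)
                (EH_space R) h.
Proof.
split; first exact: tangent_proj1.
split; first exact: proj1_metric_riemannian.
exists (EH_tensor a); split.
  by split; [exact: EH_tensor_riemannian|exact: EH_chart_pullback].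
exists (a ^+ 2 / 4); first by rewrite divr_gt0 ?exprn_gt0.
exists (proj1_to_EH a); first exact: proj1_EH_diffeomorphism.
exact: proj1_EH_pullback.
Qed.
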